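(* Let $\mathcal E$ be a nonlinear Dirichlet form on $L^2(\mu)$ satisfying the weak $\Delta_2$-condition. The following are equivalent: (i) $\mathcal E$ is subcritical; (ii) there exists a measurable $w\colon X\to(0,\infty)$ such that $\int_X|f|w\,d\mu\le\|f\|_L$ for all $f\in M(\mathcal E)$; (iii) $\ker\|\cdot\|_{L_e}=\{0\}$ (equivalently: $(M(\mathcal E_e),\|\cdot\|_{L_e})$ is a Banach space; equivalently: the embedding $(M(\mathcal E_e),\|\cdot\|_{L_e})\to L^0(\mu)$ is continuous).
   Context: $(X,\mathfrak A,\mu)$ is $\sigma$-finite; $L^0(\mu)$ carries local convergence in measure. A nonlinear Dirichlet form is a lower semicontinuous convex $\mathcal E\colon L^2(\mu)\to[0,\infty]$ with $\mathcal E(-f)=\mathcal E(f)$, $\mathcal E(0)=0$, such that $\mathcal E(f+Cg)+\mathcal E(f-Cg)\le\mathcal E(f+g)+\mathcal E(f-g)$ for all $f,g$ and all 1-Lipschitz $C\colon\mathbb R\to\mathbb R$ with $C(0)=0$. Weak $\Delta_2$-condition: $\mathcal E(f_n)\to0$ implies $\mathcal E(2f_n)\to0$ for all sequences in $L^2(\mu)$. $M(\mathcal E)=\{f:\lim_{\lambda\to0+}\mathcal E(\lambda f)=0\}$, $\|f\|_L=\inf\{\lambda>0:\mathcal E(\lambda^{-1}f)\le1\}$; $\mathcal E_e$ is the lower semicontinuous relaxation on $L^0(\mu)$ of $\mathcal E$ extended by $+\infty$, and $M(\mathcal E_e)$, $\|\cdot\|_{L_e}$ are defined analogously. Resolvent: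 $G_\alpha f$ minimizes $g\mapsto\mathcal E(g)+\frac\alpha2\|g-\alpha^{-1}f\|_2^2$; extended to nonnegative measurable functions by monotone limits; Green operator $Gf=\lim_{\alpha\to0+}G_\alpha f$. $\mathcal E$ is subcritical if there is a measurable $f\colon X\to(0,\infty)$ with $Gf<\infty$ $\mu$-a.e. *)

(* Defs.v *)
From HB Require Import structures.
From mathcomp Require Import all_boot all_order all_algebra.
From mathcomp Require Import all_classical all_reals all_analysis.
Set Implicit Arguments. Unset Strict Implicit. Unset Printing Implicit Defensive.
Import Order.TTheory GRing.Theory Num.Theory.
Import numFieldNormedType.Exports.
Local Open Scope classical_set_scope.
Local Open Scope ring_scope.
Local Open Scope ereal_scope.

Section NonlinearDirichlet.
Context {R : realType} {d : measure_display} {X : measurableType d}.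
Variable mu : {measure set X -> \bar R}.

(* Elements of L^2(mu), represented by measurable square-integrable
   real functions; equivalence classes are handled by requiring
   a.e.-invariance of the form below. *)
Definition L2 (f : X -> R) : Prop :=
  measurable_fun setT f /\ \int[mu]_x ((f x) ^+ 2)%:E < +oo.

Definition dist2sq (f g : X -> R) : \bar R :=
  \int[mu]_x ((f x - g x) ^+ 2)%:E.

Definition is_lipschitz1 (C : R -> R) : Prop :=
  forall s t : R, (`|C s - C t| <= `|s - t|)%R.

(* Nonlinear Dirichlet form on L^2(mu); E is given on all functions,
   but only its values on L2 are relevant (it is a function on classes). *)
Definition nonlinear_dirichlet_form (E : (X -> R) -> \bar R) : Prop :=
  (forall f g, L2 f -> L2 g -> {ae mu, forall x, f x = g x} -> E f = E g) /\
  (forall f, L2 f -> 0 <= E f) /\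
  (* lower semicontinuous on L^2 (metric space, so sequentially) *)
  (forall (u : nat -> X -> R) (f : X -> R), (forall n, L2 (u n)) -> L2 f ->
     (fun n => dist2sq (u n) f) @ \oo --> 0 ->
     E f <= limn_einf (fun n => E (u n))) /\
  (forall f g (t : R), L2 f -> L2 g -> (0 <= t <= 1)%R ->
     E (fun x => t * f x + (1 - t) * g x)%R
       <= t%:E * E f + (1 - t)%:E * E g) /\
  (forall f, L2 f -> E (fun x => - f x)%R = E f) /\
  E (fun=> 0%R) = 0 /\
  (forall f g (C : R -> R), L2 f -> L2 g -> is_lipschitz1 C -> C 0%R = 0%R ->
     E (fun x => f x + C (g x))%R + E (fun x => f x - C (g x))%R
       <= E (fun x => f x + g x)%R + E (fun x => f x - g x)%R).

Definition weak_delta2 (E : (X -> R) -> \bar R) : Prop :=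
  forall u : nat -> X -> R, (forall n, L2 (u n)) ->
    (fun n => E (u n)) @ \oo --> 0 ->
    (fun n => E (fun x => 2 * u n x)%R) @ \oo --> 0.

Definition MofE (E : (X -> R) -> \bar R) (f : X -> R) : Prop :=
  L2 f /\ (fun l : R => E (fun x => l * f x)%R) @ 0%R^'+ --> 0.

Definition luxnorm (E : (X -> R) -> \bar R) (f : X -> R) : \bar R :=
  ereal_inf [set l%:E | l in
    [set l : R | (0 < l)%R /\ E (fun x => l^-1 * f x)%R <= 1]].

(* basic neighbourhoods of f for local convergence in measure:
   N(f; A, e) = { g : mu(A /\ {|g - f| > e}) < e },  A measurable, mu A < oo *)
Definition lcm_nbhd (f : X -> R) (A : set X) (e : R) : set (X -> R) :=
  [set g | mu (A `&` [set x | (e < `|g x - f x|)%R]) < e%:E].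

Definition finite_measure_set (A : set X) : Prop := measurable A /\ mu A < +oo.

Definition cvg_loc_measure (u : nat -> X -> R) (f : X -> R) : Prop :=
  forall A (e : R), finite_measure_set A -> (0 < e)%R ->
    (fun n => mu (A `&` [set x | (e < `|u n x - f x|)%R])) @ \oo --> 0.

(* E_e : lower semicontinuous relaxation on L^0(mu) (w.r.t. local convergence
   in measure) of E extended by +oo outside L^2:
   E_e(f) = sup_{U nbhd of f} inf_{g in U} E~(g). *)
Definition Ee (E : (X -> R) -> \bar R) (f : X -> R) : \bar R :=
  ereal_sup [set ereal_inf [set E g | g in [set g | L2 g /\ lcm_nbhd f Ae.1 Ae.2 g]]
            | Ae in [set Ae : set X * R | finite_measure_set Ae.1 /\ (0 < Ae.2)%R]].

Definition MofEe (E : (X -> R) -> \bar R) (f : X -> R) : Prop :=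
  measurable_fun setT f /\
  (fun l : R => Ee E (fun x => l * f x)%R) @ 0%R^'+ --> 0.

Definition luxnorm_e (E : (X -> R) -> \bar R) (f : X -> R) : \bar R :=
  ereal_inf [set l%:E | l in
    [set l : R | (0 < l)%R /\ Ee E (fun x => l^-1 * f x)%R <= 1]].

Definition is_resolvent (E : (X -> R) -> \bar R) (alpha : R) (f u : X -> R) : Prop :=
  L2 u /\ forall g, L2 g ->
    E u + (alpha / 2)%:E * dist2sq u (fun x => alpha^-1 * f x)%R
    <= E g + (alpha / 2)%:E * dist2sq g (fun x => alpha^-1 * f x)%R.

Definition is_ext_resolvent (E : (X -> R) -> \bar R) (alpha : R) (f : X -> R)
    (v : X -> \bar R) : Prop :=
  exists (fs : nat -> X -> R) (us : nat -> X -> R),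
    (forall n, L2 (fs n)) /\
    (forall n x, (0 <= fs n x <= fs n.+1 x)%R) /\
    (forall x, (fs n x)%R @[n --> \oo] --> f x) /\
    (forall n, is_resolvent E alpha (fs n) (us n)) /\
    {ae mu, forall x, ((us n x)%:E) @[n --> \oo] --> v x}.

Definition is_green (E : (X -> R) -> \bar R) (f : X -> R) (w : X -> \bar R) : Prop :=
  exists v : R -> X -> \bar R,
    (forall alpha, (0 < alpha)%R -> is_ext_resolvent E alpha f (v alpha)) /\
    (forall a : nat -> R, (forall k, (0 < a k)%R) -> a @ \oo --> 0%R ->
       {ae mu, forall x, (v (a k) x) @[k --> \oo] --> w x}).

Definition subcritical (E : (X -> R) -> \bar R) : Prop :=
  exists f : X -> R, measurable_fun setT f /\ (forall x, (0 < f x)%R) /\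
    exists w : X -> \bar R, is_green E f w /\ {ae mu, forall x, w x < +oo}.

End NonlinearDirichlet.

(* Main.v *)
Require Import Defs.
From HB Require Import structures.
From mathcomp Require Import all_boot all_order all_algebra.
From mathcomp Require Import all_classical all_reals all_analysis.
From mathcomp Require Import measurable_realfun.
From mathcomp Require Import ring lra zify.
Import Order.TTheory GRing.Theory Num.Theory.
Import numFieldNormedType.Exports.
Local Open Scope classical_set_scope.
Local Open Scope ring_scope.
Set Implicit Arguments. Unset Strict Implicit. Unset Printing Implicit Defensive.

(* Everything is reduced to the weighted inequality (ii). If the kernel is trivial,
   maximize [J(g) = int g / (1 + g) p - E(g)] over [g >= 0], where [p > 0] is integrable.
   By submodularity of [E] the running maxima of a maximizing sequence stay almost
   maximal, so their energies are bounded; where their supremum [H] is infinite one finds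
   an element of the kernel, hence [H] is finite almost everywhere, and the first-order
   condition at the maximizing sequence gives (ii) with weight proportional to
   [p / (1 + H)^2]. If [E] is subcritical, testing the resolvent [u] of [f] against
   [max u g] bounds [int f (g - u)^+], and [u] stays below a finite Green potential.
   Conversely (ii) bounds [int u w] for the resolvents [u] of [w / 2], which increase as
   the parameter decreases, so that their limit is finite. Finally (ii) passes to the
   relaxed form through almost everywhere approximation and Fatou's lemma; this gives
   definiteness, the continuous embedding, and completeness. *)

(** [E] need not be differentiable and [J] need not attain its supremum in L^2, so neither an
    Euler-Lagrange equation nor a compactness argument is at hand. The order structure replaces
    both: submodularity makes a maximizing sequence monotone at the cost of a summable error, and
    resolvents are compared by exchanging minima and maxima. The integrand g / (1 + g) is chosen
    because it is bounded, which bounds [J] from above however large g is; because it is concave;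
    and because its derivative (1 + g)^-2 stays positive wherever g is finite. This derivative,
    bounded below by its value at [H], is the origin of the weight p / (1 + H)^2. The integrable p >
    0 turns sigma-finiteness into a finite measure with the same null sets. Inequalities between
    extended reals are kept free of differences until every term is known to be finite; only then
    are they passed to real arithmetic. *)

Lemma measurable_fun_norm (R : realType) (d : measure_display) (X : measurableType d)
  (D : set X) (f : X -> R) :
  measurable_fun D f -> measurable_fun D (fun x => `|f x|).
Proof. by move=> mf; apply: (measurableT_comp (@normr_measurable _ _) mf). Qed.

Ltac meas := repeat match goal with
  | |- measurable_fun _ (fun x => @?f x + @?g x) => apply: measurable_funD
  | |- measurable_fun _ (fun x => - @?f x) => apply: measurable_funN
  | |- measurable_fun _ (fun x => @?f x * @?g x) => apply: measurable_funM
  | |- measurable_fun _ (fun x => @?f x ^+ _) => apply: measurable_funX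
  | |- measurable_fun _ (fun x => Num.max (@?f x) (@?g x)) => apply: (@measurable_maxr _ _ _ _ f g)
  | |- measurable_fun _ (fun x => Num.min (@?f x) (@?g x)) => apply: (@measurable_minr _ _ _ _ f g)
  | |- measurable_fun _ (fun x => (`| @?f x |)%R) => apply: (@measurable_fun_norm _ _ _ _ f)
  | |- measurable_fun _ (fun x => EFin (@?f x)) => apply/(@measurable_EFinP _ _ _ _ f)
  | |- measurable_fun _ (fun=> ?c) => exact: measurable_cst
  | |- _ => first [assumption | eassumption]
  end.

(** * Nonnegative integrals, lower limits and Fatou's lemma *)

Section Integrals.
Context {R : realType} {d : measure_display} {X : measurableType d}.
Variable mu : {measure set X -> \bar R}.
Implicit Types f g h : X -> R.

Lemma measurable_funV f : measurable_fun setT f -> (forall x, 0 < f x) ->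
  measurable_fun setT (fun x => (f x)^-1).
Proof.
move=> mf f0; rewrite (_ : (fun x => _) = (fun x => expR (- ln (f x)))); last first.
  by apply/funext => x; rewrite expRN lnK// posrE.
apply: measurableT_comp => //; apply: measurable_funN.
by apply: measurableT_comp => //.
Qed.

Lemma le_integral_EFin f g : measurable_fun setT f -> measurable_fun setT g ->
  (forall x, 0 <= f x) -> (forall x, f x <= g x) ->
  (\int[mu]_x (f x)%:E <= \int[mu]_x (g x)%:E)%E.
Proof.
move=> mf mg f0 fg; apply: ge0_le_integral => //.
- by move=> x _; rewrite lee_fin.
- exact/measurable_EFinP.
- exact/measurable_EFinP.
- by move=> x _; rewrite lee_fin.
Qed.

Lemma integral_ge0_EFin f : (forall x, 0 <= f x) -> (0 <= \int[mu]_x (f x)%:E)%E.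
Proof. by move=> f0; apply: integral_ge0 => x _; rewrite lee_fin. Qed.

Lemma integralD_ge0_EFin f g : measurable_fun setT f -> measurable_fun setT g ->
  (forall x, 0 <= f x) -> (forall x, 0 <= g x) ->
  (\int[mu]_x (f x + g x)%:E = \int[mu]_x (f x)%:E + \int[mu]_x (g x)%:E)%E.
Proof.
move=> mf mg f0 g0; under eq_integral do rewrite EFinD.
rewrite ge0_integralD//.
- by move=> x _; rewrite lee_fin.
- exact/measurable_EFinP.
- by move=> x _; rewrite lee_fin.
- exact/measurable_EFinP.
Qed.

Lemma integralZl_ge0_EFin (k : R) f : measurable_fun setT f ->
  0 <= k -> (forall x, 0 <= f x) ->
  (\int[mu]_x (k * f x)%:E = k%:E * \int[mu]_x (f x)%:E)%E.
Proof.
move=> mf k0 f0; under eq_integral do rewrite EFinM.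
rewrite ge0_integralZl//; first exact/measurable_EFinP.
by move=> x _; rewrite lee_fin.
Qed.

Lemma limn_einf_ge (u : nat -> \bar R) (a : \bar R) :
  (\forall n \near \oo, a <= u n)%E -> (a <= limn_einf u)%E.
Proof.
move=> au; rewrite limn_einf_lim; apply: lime_ge; first exact: is_cvg_einfs.
case: au => N _ au; exists N => // n /= Nn.
by apply: le_ereal_inf_tmp => _ [m /= nm <-]; apply: au => /=; exact: leq_trans nm.
Qed.

Lemma limn_einf_le (u : nat -> \bar R) (a : \bar R) :
  (\forall n \near \oo, u n <= a)%E -> (limn_einf u <= a)%E.
Proof.
move=> au; rewrite limn_einf_lim; apply: lime_le; first exact: is_cvg_einfs.
case: au => N _ au; exists N => // n /= Nn.
by apply: (le_trans _ (au n Nn)); apply: ereal_inf_lbound; exists n => /=.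
Qed.

Lemma measurable_fun_limn_einf (F : nat -> X -> \bar R) :
  (forall n, measurable_fun setT (F n)) ->
  measurable_fun setT (fun x => limn_einf (F ^~ x)).
Proof.
move=> mF; apply: (@measurableT_comp _ _ _ _ _ _ (@oppe R)) => //.
by apply: measurable_fun_limn_esup => n; exact: measurableT_comp.
Qed.

Lemma limn_einf_ge0 (u : nat -> \bar R) : (forall n, 0 <= u n)%E ->
  (0 <= limn_einf u)%E.
Proof. by move=> u0; apply: limn_einf_ge; exact: nearW. Qed.

(** Comparing with a separate [G], and only almost everywhere, lets [G] be a measurable candidate
    that agrees with the limit off a null set. *)
Lemma fatou_ae (F : nat -> X -> \bar R) (G : X -> \bar R) :
  (forall n, measurable_fun setT (F n)) -> (forall n x, 0 <= F n x)%E ->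
  measurable_fun setT G -> (forall x, 0 <= G x)%E ->
  {ae mu, forall x, (G x <= limn_einf (F ^~ x))%E} ->
  (\int[mu]_x G x <= limn_einf (fun n => \int[mu]_x F n x))%E.
Proof.
move=> mF F0 mG G0 GF.
apply: (@le_trans _ _ (\int[mu]_x limn_einf (F ^~ x))%E).
  apply: ae_ge0_le_integral => //.
  - by move=> x _; exact: limn_einf_ge0.
  - exact: measurable_fun_limn_einf.
  - by apply: filterS GF => x + _.
by apply: fatou => // n x _; exact: F0.
Qed.

Lemma fatou_le (F : nat -> X -> \bar R) (G : X -> \bar R) (C : \bar R) :
  (forall n, measurable_fun setT (F n)) -> (forall n x, 0 <= F n x)%E ->
  measurable_fun setT G -> (forall x, 0 <= G x)%E ->
  {ae mu, forall x, (G x <= limn_einf (F ^~ x))%E} ->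
  (\forall n \near \oo, \int[mu]_x F n x <= C)%E ->
  (\int[mu]_x G x <= C)%E.
Proof.
by move=> mF F0 mG G0 GF FC; exact: le_trans (fatou_ae mF F0 mG G0 GF) (limn_einf_le FC).
Qed.

Lemma integral_lty_ae (G : X -> \bar R) : measurable_fun setT G ->
  (forall x, 0 <= G x)%E -> (\int[mu]_x G x < +oo)%E ->
  {ae mu, forall x, (G x < +oo)%E}.
Proof.
move=> mG G0 iG.
have GI : mu.-integrable setT G.
  apply/integrableP; split => //.
  by under eq_integral do rewrite gee0_abs//.
apply: filterS (integrable_ae measurableT GI) => x /(_ I).
by rewrite ge0_fin_numE.
Qed.

Lemma integral_eq0_ae f : measurable_fun setT f -> (forall x, 0 <= f x) ->
  (\int[mu]_x (f x)%:E <= 0)%E -> {ae mu, forall x, f x = 0}.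
Proof.
move=> mf f0 if0.
have /(ae_eq_integral_abs mu measurableT) : measurable_fun setT (EFin \o f).
  exact/measurable_EFinP.
case=> + _; move=> H.
have /H : (\int[mu]_x `|(EFin \o f) x| = 0)%E.
  under eq_integral do rewrite gee0_abs ?lee_fin//.
  by apply/eqP; rewrite eq_le if0/= integral_ge0_EFin.
by apply: filterS => x /(_ I)[].
Qed.

End Integrals.

(** * Vector space and lattice operations on square-integrable functions *)

Section L2.
Context {R : realType} {d : measure_display} {X : measurableType d}.
Variable mu : {measure set X -> \bar R}.
Implicit Types f g h : X -> R.
Local Notation L2 := (L2 mu).

(** The common source of the closure properties under sums, maxima, minima and domination; it rests
    on (b + c)^2 <= 2 (b^2 + c^2). *)
Lemma L2_bound f g h : L2 f -> L2 g -> measurable_fun setT h ->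
  (forall x, `|h x| <= `|f x| + `|g x|) -> L2 h.
Proof.
move=> [mf if2] [mg ig2] mh hfg; split=> //.
apply: (@le_lt_trans _ _ (\int[mu]_x (2 * (f x ^+ 2 + g x ^+ 2))%:E)%E).
  apply: le_integral_EFin; [by meas|by meas|by move=> x; exact: sqr_ge0|].
  move=> x; have := hfg x; rewrite -(real_normK (num_real (h x))).
  rewrite -(real_normK (num_real (f x))) -(real_normK (num_real (g x))).
  have := normr_ge0 (h x); have := normr_ge0 (f x); have := normr_ge0 (g x).
  move: `|h x| `|f x| `|g x| => a b c c0 b0 a0 abc.
  apply: (@le_trans _ _ ((b + c) ^+ 2)); first by rewrite ler_sqr ?nnegrE ?addr_ge0.
  by have := sqr_ge0 (b - c); nra.
rewrite integralZl_ge0_EFin; [|by meas|lra|by move=> x; rewrite addr_ge0 ?sqr_ge0].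
rewrite integralD_ge0_EFin; [|by meas|by meas|by move=> x; exact: sqr_ge0|by move=> x; exact: sqr_ge0].
by rewrite lte_mul_pinfty// lte_add_pinfty.
Qed.

Lemma L2_0 : L2 (fun=> 0).
Proof.
split; first exact: measurable_cst.
by under eq_integral do rewrite expr0n/=; rewrite integral0.
Qed.

Lemma L2D f g : L2 f -> L2 g -> L2 (fun x => f x + g x).
Proof.
move=> f2 g2; case: (f2) (g2) => mf _ [mg _].
by apply: (L2_bound f2 g2) => [|x]; [meas|exact: ler_normD].
Qed.

Lemma L2B f g : L2 f -> L2 g -> L2 (fun x => f x - g x).
Proof.
move=> f2 g2; case: (f2) (g2) => mf _ [mg _].
by apply: (L2_bound f2 g2) => [|x]; [meas|exact: ler_normB].
Qed.

Lemma L2Z (k : R) f : L2 f -> L2 (fun x => k * f x).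
Proof.
move=> [mf if2]; split; first by meas.
under eq_integral do rewrite exprMn.
rewrite integralZl_ge0_EFin; [|by meas|exact: sqr_ge0|by move=> x; exact: sqr_ge0].
by rewrite lte_mul_pinfty// lee_fin sqr_ge0.
Qed.

Lemma L2_dom f g : L2 g -> measurable_fun setT f ->
  (forall x, `|f x| <= `|g x|) -> L2 f.
Proof.
by move=> g2 mf fg; apply: (L2_bound g2 L2_0 mf) => x; rewrite normr0 addr0.
Qed.

Lemma L2_norm f : L2 f -> L2 (fun x => `|f x|).
Proof.
by move=> f2; case: (f2) => mf _; apply: (L2_dom f2) => [|x]; [meas|rewrite normr_id].
Qed.

Lemma L2_max f g : L2 f -> L2 g -> L2 (fun x => Num.max (f x) (g x)).
Proof.
move=> f2 g2; case: (f2) (g2) => mf _ [mg _].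
apply: (L2_bound f2 g2) => [|x]; first by meas.
by case: (leP (f x) (g x)) => _; rewrite ?lerDl ?lerDr.
Qed.

Lemma L2_min f g : L2 f -> L2 g -> L2 (fun x => Num.min (f x) (g x)).
Proof.
move=> f2 g2; case: (f2) (g2) => mf _ [mg _].
apply: (L2_bound f2 g2) => [|x]; first by meas.
by case: (leP (f x) (g x)) => _; rewrite ?lerDl ?lerDr.
Qed.

Lemma integral_L2_mul_lty f g : L2 f -> L2 g -> (forall x, 0 <= f x) ->
  (forall x, 0 <= g x) -> (\int[mu]_x (f x * g x)%:E < +oo)%E.
Proof.
move=> [mf if2] [mg ig2] f0 g0.
apply: (@le_lt_trans _ _ (\int[mu]_x (f x ^+ 2 + g x ^+ 2)%:E)%E).
  apply: le_integral_EFin; [by meas|by meas|by move=> x; rewrite mulr_ge0|].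
  move=> x; nra.
rewrite integralD_ge0_EFin; [|by meas|by meas|by move=> x; exact: sqr_ge0|by move=> x; exact: sqr_ge0].
by rewrite lte_add_pinfty.
Qed.

End L2.

(** * Contraction, submodularity and scaling of the form *)

Section Form.
Context {R : realType} {d : measure_display} {X : measurableType d}.
Variable mu : {measure set X -> \bar R}.
Variable E : (X -> R) -> \bar R.
Hypothesis hE : nonlinear_dirichlet_form mu E.
Implicit Types f g h : X -> R.
Local Notation L2 := (L2 mu).

Lemma E_ge0 f : L2 f -> (0 <= E f)%E.
Proof. by have [_ [h _]] := hE; exact: h. Qed.

Lemma E_lsc (u : nat -> X -> R) f : (forall n, L2 (u n)) -> L2 f ->
  (fun n => dist2sq mu (u n) f) @ \oo --> 0%E ->
  (E f <= limn_einf (fun n => E (u n)))%E.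
Proof. by have [_ [_ [h _]]] := hE; exact: h. Qed.

Lemma E_convex f g (t : R) : L2 f -> L2 g -> (0 <= t <= 1)%R ->
  (E (fun x => t * f x + (1 - t) * g x)%R <= t%:E * E f + (1 - t)%:E * E g)%E.
Proof. by have [_ [_ [_ [h _]]]] := hE; exact: h. Qed.

Lemma E_opp f : L2 f -> E (fun x => - f x) = E f.
Proof. by have [_ [_ [_ [_ [h _]]]]] := hE; exact: h. Qed.

Lemma E_0 : E (fun=> 0) = 0%E.
Proof. by have [_ [_ [_ [_ [_ [h _]]]]]] := hE; exact: h. Qed.

Lemma E_contraction2 f g (C : R -> R) : L2 f -> L2 g -> is_lipschitz1 C -> C 0 = 0 ->
  (E (fun x => f x + C (g x))%R + E (fun x => f x - C (g x))%R
       <= E (fun x => f x + g x)%R + E (fun x => f x - g x)%R)%E.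
Proof. by have [_ [_ [_ [_ [_ [_ h]]]]]] := hE; exact: h. Qed.

Lemma lipschitz1_measurable (C : R -> R) : is_lipschitz1 C -> measurable_fun setT C.
Proof.
move=> hC; apply: continuous_measurable_fun => x; apply/cvgrPdist_le => /= e e0.
near=> t; apply: le_trans (hC _ _) _; near: t; apply: cvgr_dist_le => //.
Unshelve. all: by end_near. Qed.

Lemma L2_contraction g (C : R -> R) : L2 g -> is_lipschitz1 C -> C 0 = 0 ->
  L2 (fun x => C (g x)).
Proof.
move=> g2 hC C0; case: (g2) => mg _; apply: (L2_dom g2).
  by apply: (measurableT_comp (lipschitz1_measurable hC) mg).
by move=> x; have := hC (g x) 0; rewrite C0 !subr0.
Qed.

(** With f = 0 in the two-function inequality, evenness turns both sides into doubles: 2 E(C g) <= 2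
    E(g). *)
Lemma E_contraction g (C : R -> R) : L2 g -> is_lipschitz1 C -> C 0 = 0 ->
  (E (fun x => C (g x)) <= E g)%E.
Proof.
move=> g2 hC C0; have Cg2 := L2_contraction g2 hC C0.
have := E_contraction2 (L2_0 mu) g2 hC C0.
under eq_fun do rewrite add0r.
rewrite [X in (_ + E X <= _)%E](_ : _ = fun x => - C (g x)); last first.
  by apply/funext => x; rewrite sub0r.
rewrite [X in (_ <= E X + _)%E](_ : _ = g); last first.
  by apply/funext => x; rewrite add0r.
rewrite [X in (_ <= _ + E X)%E](_ : _ = fun x => - g x); last first.
  by apply/funext => x; rewrite sub0r.
rewrite !E_opp//.
have := E_ge0 Cg2; have := E_ge0 g2.
case: (E g) => [a| |]; case: (E _) => [b| |] //=; rewrite ?leey// -!EFinD !lee_fin; lra.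
Qed.

Lemma E_norm g : L2 g -> (E (fun x => `|g x|%R) <= E g)%E.
Proof.
move=> g2; apply: (@E_contraction g (fun t => `|t|)) => //; last by rewrite normr0.
by move=> s t; exact: ler_dist_dist.
Qed.

Lemma E_min (c : R) g : 0 <= c -> L2 g -> (E (fun x => Num.min (g x) c) <= E g)%E.
Proof.
move=> c0 g2; apply: (@E_contraction g (fun t => Num.min t c)) => //; last by case: (leP 0 c) => //; lra.
move=> s t; rewrite ler_norml.
by case: (leP s c) => hs; case: (leP t c) => ht; case: (leP 0 (s - t)) => h;
  rewrite ?(ger0_norm h) ?(ltr0_norm h); lra.
Qed.

(* Apply the contraction property to [(f + g) / 2] and [(f - g) / 2] with [C = |.|]. *)
Lemma E_submodular f g : L2 f -> L2 g ->
  (E (fun x => Num.max (f x) (g x)) + E (fun x => Num.min (f x) (g x))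
   <= E f + E g)%E.
Proof.
move=> f2 g2.
pose a x := 2^-1 * (f x + g x); pose b x := 2^-1 * (f x - g x).
have a2 : L2 a by apply: L2Z; exact: L2D.
have b2 : L2 b by apply: L2Z; exact: L2B.
have nL : is_lipschitz1 (fun t : R => `|t|) by move=> s t; exact: ler_dist_dist.
have := E_contraction2 a2 b2 nL (normr0 _).
have e1 : (fun x => a x + `|b x|) = (fun x => Num.max (f x) (g x)).
  apply/funext => x; rewrite /a /b normrM ger0_norm; last lra.
  by case: (leP (f x) (g x)) => h; [rewrite ler0_norm|rewrite gtr0_norm]; lra.
have e2 : (fun x => a x - `|b x|) = (fun x => Num.min (f x) (g x)).
  apply/funext => x; rewrite /a /b normrM ger0_norm; last lra.
  by case: (leP (f x) (g x)) => h; [rewrite ler0_norm|rewrite gtr0_norm]; lra.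
have e3 : (fun x => a x + b x) = f by apply/funext => x; rewrite /a /b; lra.
have e4 : (fun x => a x - b x) = g by apply/funext => x; rewrite /a /b; lra.
by rewrite e1 e2 e3 e4.
Qed.

Lemma E_scale (t : R) f : L2 f -> 0 <= t <= 1 -> (E (fun x => (t * f x)%R) <= t%:E * E f)%E.
Proof.
move=> f2 t01; have := E_convex f2 (L2_0 mu) t01.
rewrite E_0 mule0 adde0; under [X in (E X <= _)%E -> _]eq_fun do rewrite mulr0 addr0.
by [].
Qed.

Lemma E_max f g : L2 f -> L2 g ->
  (E (fun x => Num.max (f x) (g x)) <= E f + E g)%E.
Proof.
move=> f2 g2; apply: le_trans (E_submodular f2 g2).
by rewrite leeDl// E_ge0//; exact: L2_min.
Qed.

Lemma MofE_lty f : L2 f -> (E f < +oo)%E -> MofE mu E f.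
Proof.
move=> f2 Ef; split=> //.
have [e Ee] : exists e, E f = e%:E.
  by exists (fine (E f)); rewrite fineK// ge0_fin_numE// E_ge0.
apply/cvge_at_rightP => u [u0 ul].
apply: (@squeeze_cvge _ _ _ _ (cst 0%E) _ (fun n => (u n * e)%:E)).
- near=> n; rewrite /= E_ge0/=; last exact: L2Z.
  rewrite EFinM -Ee; apply: E_scale => //; rewrite (ltW (u0 n))/=.
  by near: n; apply: (cvgr_le 0) => //.
- exact: cvg_cst.
- apply: cvg_EFin; first exact: nearW.
  by rewrite -(mul0r e); apply: cvgM => //; exact: cvg_cst.
Unshelve. all: by end_near. Qed.

(** The left side is homogeneous in [f], so a bound by the infimum is a bound by 1 for each
    admissible rescaling. *)
Lemma luxnorm_ge (w : X -> R) f : measurable_fun setT w -> measurable_fun setT f ->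
  (forall x, 0 <= w x) ->
  (forall (l : R), 0 < l -> (E (fun x => (l^-1 * f x)%R) <= 1)%E ->
     (\int[mu]_x (`|l^-1 * f x| * w x)%:E <= 1)%E) ->
  (\int[mu]_x (`|f x| * w x)%:E <= luxnorm E f)%E.
Proof.
move=> mw mf w0 H; apply: le_ereal_inf_tmp => _ [l [l0 El] <-].
have := H l l0 El.
rewrite (_ : (fun x => (`|l^-1 * f x| * w x)%:E) = (fun x => (l^-1 * (`|f x| * w x))%:E)); last first.
  by apply/funext => x; rewrite normrM gtr0_norm ?invr_gt0// mulrA.
rewrite integralZl_ge0_EFin; [|by meas|by rewrite invr_ge0 ltW|by move=> x; rewrite mulr_ge0].
by rewrite lee_pdivrMl// mule1.
Qed.

(** Both derivations of (ii) end here. Passing to |f| does not increase [E], rescaling reduces to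
    the unit ball, and the constant [C] is absorbed into the weight. *)
Lemma hardy_of_unit_ball (w : X -> R) (C : R) : measurable_fun setT w ->
  (forall x, 0 < w x) -> 0 < C ->
  (forall g, L2 g -> (forall x, 0 <= g x) -> (E g <= 1)%E ->
    (\int[mu]_x (g x * w x)%:E <= C%:E)%E) ->
  exists w : X -> R, measurable_fun setT w /\ (forall x, 0 < w x) /\
    forall f, MofE mu E f -> (\int[mu]_x (`|f x| * w x)%:E <= luxnorm E f)%E.
Proof.
move=> mw w0 C0 key; exists (fun x => C^-1 * w x); split; first by meas.
split; first by move=> x; rewrite mulr_gt0// invr_gt0.
move=> g [g2 _]; have [mg _] := g2.
apply: luxnorm_ge => //; first by meas.
  by move=> x; rewrite mulr_ge0 ?invr_ge0 ?ltW.
move=> l l0 El; have lg2 := L2Z l^-1 g2.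
have := key _ (L2_norm lg2) (fun x => normr_ge0 _).
move=> /(_ (le_trans (E_norm lg2) El)).
under [X in _ -> (X <= _)%E]eq_integral do rewrite mulrCA.
rewrite integralZl_ge0_EFin; [|by meas|by rewrite invr_ge0 ltW|by move=> x; rewrite mulr_ge0// ltW].
by rewrite lee_pdivrMl// mule1.
Qed.

End Form.

(** * A bounded, strictly positive, integrable weight *)

Section SigmaFiniteWeight.
Context {R : realType} {d : measure_display} {X : measurableType d}.
Variable mu : {measure set X -> \bar R}.

Lemma sigma_finite_weight : sigma_finite setT mu ->
  exists p : X -> R, [/\ measurable_fun setT p, forall x, 0 < p x, forall x, p x <= 1
    & (\int[mu]_x (p x)%:E < +oo)%E].
Proof.
move=> [F FT mF].
(* The weight is the sum of [c i] times the indicator of [F i]. The powers of two make the [c i] sum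
   to at most 1, which bounds the weight; the factor (1 + mu(F i))^-1 makes the sum of c_i mu(F_i)
   at most 1 as well, which bounds its integral. *)
pose c i : R := (1 + fine (mu (F i)))^-1 / 2 ^+ i.+1.
have m0 i : 0 <= fine (mu (F i)) by rewrite fine_ge0.
have c0 i : 0 < c i by rewrite divr_gt0 ?exprn_gt0// invr_gt0; have := m0 i; lra.
have c1 i : c i <= 1 / 2 ^+ i.+1.
  rewrite /c ler_wpM2r ?invr_ge0 ?exprn_ge0// invf_le1; first by have := m0 i; lra.
  by have := m0 i; lra.
pose P i x : \bar R := (c i * \1_(F i) x)%:E.
have P0 i x : (0 <= P i x)%E by rewrite lee_fin mulr_ge0 ?(ltW (c0 _))// indicE ler0n.
have mP i : measurable_fun setT (P i).
  by rewrite /P; meas; apply: measurable_indic; case: (mF i).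
have e1 : (\sum_(0 <= i <oo) ((1 / 2 ^+ i.+1)%:E : \bar R) <= 1)%E.
  have := @epsilon_trick0 R 1 xpredT ler01.
  by under eq_eseriesr do rewrite natrX.
pose S x : \bar R := (\sum_(0 <= i <oo) P i x)%E.
have S0 x : (0 <= S x)%E by apply: nneseries_ge0.
have S1 x : (S x <= 1)%E.
  apply: le_trans e1; apply: lee_nneseries => //= i _; rewrite lee_fin; apply: le_trans (c1 i).
  by rewrite indicE; case: (_ \in _); rewrite ?mulr1 ?mulr0// ltW.
have Sf x : S x \is a fin_num by rewrite ge0_fin_numE//; apply: le_lt_trans (S1 x) _; exact: ltry.
have mS : measurable_fun setT S by apply: ge0_emeasurable_sum.
exists (fine \o S); split.
- exact: measurableT_comp.
- move=> x; rewrite /= fine_gt0//; apply/andP; split; last by apply: le_lt_trans (S1 x) _; exact: ltry.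
  have [i _ Fix] : (\bigcup_i F i) x by rewrite -FT.
  apply: (@lt_le_trans _ _ (P i x)).
    by rewrite lte_fin indicE mem_set// mulr1.
  rewrite /S (@nneseriesD1 _ _ i)// leeDl//; exact: nneseries_ge0.
- by move=> x; rewrite -lee_fin /= fineK.
- apply: (@le_lt_trans _ _ 1%E); last exact: ltry.
  under eq_integral do rewrite /= fineK//.
  rewrite /S integral_nneseries//; apply: le_trans e1; apply: lee_nneseries => [i _ _|i _ /=]; first by apply: integral_ge0 => x _; exact: P0.
  rewrite /P integralZl_ge0_EFin//; [|by apply: measurable_indic; case: (mF i)|exact: ltW].
  rewrite integral_indic//; last by case: (mF i).
  rewrite setIT -(@fineK _ (mu (F i))); last by rewrite ge0_fin_numE//; case: (mF i).
  rewrite -EFinM lee_fin /c -mulrA ler_pdivrMl; have := m0 i; last lra.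
  move=> m; rewrite mul1r [_^-1 * _]mulrC ler_wpM2r ?invr_ge0 ?exprn_ge0//; lra.
Qed.
End SigmaFiniteWeight.

(** * From a finite Green potential to the weighted inequality *)

Section SubcriticalHardy.
Context {R : realType} {d : measure_display} {X : measurableType d}.
Variable mu : {measure set X -> \bar R}.
Variable E : (X -> R) -> \bar R.
Hypothesis hE : nonlinear_dirichlet_form mu E.
Implicit Types f g h : X -> R.
Local Notation L2 := (L2 mu).

Lemma ge0_lty_EFin (x : \bar R) : (0 <= x -> x < +oo -> exists2 r : R, (0 <= r)%R & x = r%:E)%E.
Proof.
move=> x0 xy; exists (fine x); first exact: fine_ge0.
by rewrite fineK// ge0_fin_numE.
Qed.

Lemma dist2sq_lty f g : L2 f -> L2 g -> (dist2sq mu f g < +oo)%E.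
Proof. by move=> f2 g2; have [] := L2B f2 g2. Qed.

Lemma dist2sq_ge0 f g : (0 <= dist2sq mu f g)%E.
Proof. by apply: integral_ge0_EFin => x; exact: sqr_ge0. Qed.

Lemma resolvent_E_lty (a : R) f u : 0 < a -> L2 f -> is_resolvent mu E a f u -> (E u < +oo)%E.
Proof.
move=> a0 f2 [u2 /(_ _ (L2_0 mu))]; rewrite (E_0 hE) add0e => h.
apply: (@le_lt_trans _ _ (E u + (a / 2)%:E * dist2sq mu u (fun x => (a^-1 * f x)%R))%E).
  by rewrite leeDl// mule_ge0 ?dist2sq_ge0// lee_fin; lra.
apply: le_lt_trans h _; rewrite lte_mul_pinfty//; first by rewrite lee_fin; lra.
by apply: dist2sq_lty; [exact: L2_0|exact: L2Z].
Qed.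

(* Compare the resolvent [u] with the competitor [max u phi]. *)
Lemma resolvent_test (a : R) f u phi : 0 < a -> L2 f -> (forall x, 0 <= f x) ->
  is_resolvent mu E a f u -> L2 phi -> (E phi < +oo)%E ->
  (\int[mu]_x (f x * Num.max (phi x - u x) 0)%:E
    <= E phi + (a / 2)%:E * \int[mu]_x (phi x ^+ 2)%:E)%E.
Proof.
move=> a0 f2 f0 ru phi2 Ephi; have Eu := resolvent_E_lty a0 f2 ru.
case: ru => u2 umin; pose m x := Num.max (u x) (phi x).
have m2 : L2 m by exact: L2_max.
have Em : (E m <= E u + E phi)%E by exact: (E_max hE).
have ah : 0 <= a / 2 by lra.
case: (f2) (u2) (phi2) (m2) => mf _ [mu' _] [mphi _] [mm _].
(* Pointwise, with c = f / a: where u <= phi the mixed terms cancel and the right side exceeds the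
   left by a u^2 / 2; elsewhere it exceeds it by a phi^2 / 2. *)
have key : ((a / 2)%:E * dist2sq mu m (fun x => (a^-1 * f x)%R) +
    \int[mu]_x (f x * Num.max (phi x - u x) 0)%:E <=
    (a / 2)%:E * dist2sq mu u (fun x => (a^-1 * f x)%R) +
    (a / 2)%:E * \int[mu]_x (phi x ^+ 2)%:E)%E.
  rewrite /dist2sq -!integralZl_ge0_EFin//; try solve [by meas|by move=> x; exact: sqr_ge0].
  rewrite -!integralD_ge0_EFin; try solve [by meas|by move=> x; rewrite mulr_ge0 ?sqr_ge0// le_max lexx orbT].
  apply: le_integral_EFin; [by meas|by meas| |].
    by move=> x; rewrite addr_ge0// mulr_ge0 ?sqr_ge0// le_max lexx orbT.
  move=> x; have aV : f x = a * (a^-1 * f x) by rewrite mulrA divff ?mul1r ?gt_eqF.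
  rewrite {2}aV /m; move: (a^-1 * f x) => c.
  case: (leP (u x) (phi x)) => hx.
    rewrite max_l; last lra.
    by have := sqr_ge0 (u x); nra.
  rewrite max_r; last lra.
  by have := sqr_ge0 (phi x); nra.
have := umin _ m2; move: key Em Ephi Eu.
have := E_ge0 hE u2; have := E_ge0 hE phi2; have := E_ge0 hE m2.
have := dist2sq_lty m2 (L2Z a^-1 f2).
have := dist2sq_ge0 m (fun x => a^-1 * f x).
have := dist2sq_lty u2 (L2Z a^-1 f2).
have := dist2sq_ge0 u (fun x => a^-1 * f x).
have : (0 <= \int[mu]_x (f x * Num.max (phi x - u x) 0)%:E)%E.
  by apply: integral_ge0_EFin => x; rewrite mulr_ge0// le_max lexx orbT.
have : (0 <= \int[mu]_x (phi x ^+ 2)%:E)%E.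
  by apply: integral_ge0_EFin => x; exact: sqr_ge0.
case: phi2 => _.
case: (\int[mu]_x (phi x ^+ 2)%:E)%E => [b| |]// _.
case: (\int[mu]_x _)%E => [i| |]//.
move=> _ _; case: (dist2sq _ _ _) => [x1| |]// _ _; case: (dist2sq _ _ _) => [x2| |]// _ _.
case: (E m) => [y1| |]//; case: (E phi) => [y2| |]//; case: (E u) => [y3| |]//.
  by rewrite -!EFinM -!EFinD !lee_fin => *; lra.
move=> _ _; case: (dist2sq _ _ _) => [x1| |]// _ _; case: (dist2sq _ _ _) => [x2| |]// _ _.
Qed.

Lemma le_limn_einf (u v : nat -> \bar R) :
  (\forall n \near \oo, u n <= v n)%E -> (limn_einf u <= limn_einf v)%E.
Proof.
move=> uv; rewrite !limn_einf_lim; apply: lee_lim; [exact: is_cvg_einfs|exact: is_cvg_einfs|].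
case: uv => N _ uv; exists N => // n /= Nn.
apply: le_ereal_inf_tmp => _ [m /= nm <-]; apply: (le_trans _ (uv m _)); last exact: leq_trans nm.
by apply: ereal_inf_lbound; exists m.
Qed.

Lemma near_cvge_lt (u : nat -> \bar R) (l m : \bar R) : (l < m)%E -> u @ \oo --> l ->
  (\forall n \near \oo, u n < m)%E.
Proof. by move=> lm ul; exact: (ul _ (open_ereal_lt' lm)). Qed.

Lemma subcritical_hardy : sigma_finite setT mu -> subcritical mu E ->
  exists w : X -> R, measurable_fun setT w /\ (forall x, 0 < w x) /\
      forall f, MofE mu E f -> (\int[mu]_x (`|f x| * w x)%:E <= luxnorm E f)%E.
Proof.
move=> /sigma_finite_weight[p [mp p0 p1 ip]] [f [mf [f0 [W [[v [hv vW]] Wfin]]]]].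
pose a k : R := harmonic k.
have a0 k : 0 < a k by rewrite /a /= invr_gt0.
have acv : a @ \oo --> (0 : R) by exact: cvg_harmonic.
have /choice[fs] := fun k => hv (a k) (a0 k).
move=> /choice[us] H.
have fs2 k n : L2 (fs k n) by case: (H k).
have fs0 k n x : 0 <= fs k n x by case: (H k) => _ [/(_ n x)/andP[]].
have fscv k x : fs k n x @[n --> \oo] --> f x by case: (H k) => _ [_ []].
have rus k n : is_resolvent mu E (a k) (fs k n) (us k n) by case: (H k) => _ [_ [_ []]].
have usv : {ae mu, forall x, forall k, (us k n x)%:E @[n --> \oo] --> v (a k) x}.
  by apply: ae_foralln => k; case: (H k) => _ [_ [_ []]].
have us2 k n : L2 (us k n) by case: (rus k n).
have mfs k n : measurable_fun setT (fs k n) by case: (fs2 k n).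
have mus k n : measurable_fun setT (us k n) by case: (us2 k n).
(* [W] is only an almost everywhere limit and is not known to be measurable. [Z] is a measurable
   function equal to it off a null set. *)
pose Z x : \bar R := limn_esup (fun k => limn_esup (fun n => (us k n x)%:E)).
have mZ : measurable_fun setT Z.
  apply: measurable_fun_limn_esup => k; apply: measurable_fun_limn_esup => n.
  exact/measurable_EFinP.
(* The added 1 places [M] strictly above the potential where that is finite, so that the
   approximating resolvents eventually fall below [M]. *)
pose M x : R := 1 + fine (maxe (Z x) 0%E).
have mM : measurable_fun setT M.
  rewrite /M; apply: measurable_funD => //; apply: measurableT_comp => //.
  exact: measurable_maxe.
have M1 x : 1 <= M x by rewrite lerDl fine_ge0// le_max lexx orbT.
have M0 x : 0 < M x by apply: lt_le_trans (M1 x).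
have mMV : measurable_fun setT (fun x => (M x)^-1) by exact: measurable_funV.
(* This choice gives g w <= p + f (g - M)^+: below [M] one has g w <= M w <= p, and the excess g - M
   is paid for by w <= f. *)
pose w x := Num.min (f x) (p x * (M x)^-1).
have mw : measurable_fun setT w by rewrite /w; meas.
have w0 x : 0 < w x by rewrite lt_min f0/= divr_gt0.
have ip0 : (0 <= \int[mu]_x (p x)%:E)%E by apply: integral_ge0_EFin => x; exact: ltW.
have [c c0 ipc] := ge0_lty_EFin ip0 ip.
have key g : L2 g -> (forall x, 0 <= g x) -> (E g <= 1)%E ->
    (\int[mu]_x (g x * w x)%:E <= (c + 2)%:E)%E.
  move=> g2 g0 Eg; have [mg ig2] := g2.
  pose q k n x : \bar R := (fs k n x * Num.max (g x - us k n x) 0)%:E.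
  have q0 k n x : (0 <= q k n x)%E by rewrite lee_fin mulr_ge0// le_max lexx orbT.
  have mq k n : measurable_fun setT (q k n) by rewrite /q; meas.
  pose Q k x := limn_einf (fun n => q k n x).
  have Q0 k x : (0 <= Q k x)%E by exact: limn_einf_ge0.
  have mQ k : measurable_fun setT (Q k) by exact: measurable_fun_limn_einf.
  pose T x := limn_einf (fun k => Q k x).
  have T0 x : (0 <= T x)%E by exact: limn_einf_ge0.
  have mT : measurable_fun setT T by exact: measurable_fun_limn_einf.
  have [s s0 is_] := ge0_lty_EFin (integral_ge0_EFin mu (fun x => sqr_ge0 (g x))) ig2.
  have iQ k : (\int[mu]_x Q k x <= (1 + a k / 2 * s)%:E)%E.
    apply: (@fatou_le _ _ _ mu (q k)) => //; first by apply: aeW.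
    apply: nearW => n; have := @resolvent_test (a k) (fs k n) (us k n) g.
    move=> /(_ (a0 k) (fs2 k n) (fs0 k n) (rus k n) g2).
    have Ey : (E g < +oo)%E by apply: le_lt_trans Eg _; exact: ltry.
    move=> /(_ Ey) /le_trans; apply; rewrite is_ EFinD EFinM; exact: leeD.
  (* The quadratic term a_k s / 2 tends to zero, so any constant above the bound 1 on [E g] would do
     in place of 2. *)
  have iT : (\int[mu]_x T x <= 2%:E)%E.
    apply: (@fatou_le _ _ _ mu Q) => //; first by apply: aeW.
    have : (fun k => 1 + a k / 2 * s) @ \oo --> (1 + 0 / 2 * s : R).
      apply: cvgD; first exact: cvg_cst.
      by apply: cvgMl; apply: cvgMl.
    rewrite !mul0r addr0 => cv.
    have : \forall k \near \oo, 1 + a k / 2 * s <= 2 by apply: (cvgr_le 1 cv); lra.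
    by apply: filterS => k h; apply: le_trans (iQ k) _; rewrite lee_fin.
  apply: (@le_trans _ _ (\int[mu]_x ((p x)%:E + T x))%E).
    apply: ae_ge0_le_integral => //.
    - by move=> x _; rewrite lee_fin mulr_ge0// ltW.
    - by meas.
    - by move=> x _; rewrite adde_ge0// lee_fin ltW.
    - by apply: emeasurable_funD => //; exact/measurable_EFinP.
    have {}vW := vW a a0 acv.
    apply: filterS3 usv vW Wfin => x usx vx Wx _.
    have ZW : Z x = W x.
      rewrite /Z (_ : (fun k => _) = (fun k => v (a k) x)); last first.
        by apply/funext => k; have [_ ->] := cvg_limn_einf_sup (usx k).
      by have [_ ->] := cvg_limn_einf_sup vx.
    have WM : (W x < (M x)%:E)%E.
      rewrite /M -ZW EFinD fineK; last first.
        rewrite ge0_fin_numE; first by rewrite gt_max ZW Wx ltry.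
        by rewrite le_max lexx orbT.
      have := Wx; rewrite -ZW; case: (Z x) => [z| |]// _; last by rewrite maxNye adde0 ltNyr.
      by rewrite -EFin_max -EFinD lte_fin; case: (leP z 0) => ?; lra.
    (* Both limits are used strictly: v(a_k) is eventually below [M] at x, and for each such k so is
       the n-th resolvent eventually. Replacing the resolvent by [M] only decreases the positive
       part. *)
    have TT : ((f x * Num.max (g x - M x) 0)%:E <= T x)%E.
      apply: limn_einf_ge; have := near_cvge_lt WM vx.
      apply: filterS => k vM; have := near_cvge_lt vM (usx k) => uM.
      have cv : (fs k n x * Num.max (g x - M x) 0)%:E @[n --> \oo] --> (f x * Num.max (g x - M x) 0)%:E.
        apply: cvg_EFin; first exact: nearW.
        by apply: cvgMl; exact: fscv.
      have [<- _] := cvg_limn_einf_sup cv.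
      apply: le_limn_einf; apply: filterS uM => n; rewrite lte_fin => uM.
      rewrite lee_fin ler_wpM2l//.
      by case: (leP (g x - M x) 0) => ?; rewrite le_max ?lexx ?orbT//; apply/orP; left; lra.
    apply: (@le_trans _ _ ((p x)%:E + (f x * Num.max (g x - M x) 0)%:E)%E); last exact: leeD2l.
    have wf : w x <= f x by rewrite ge_min lexx.
    have wp : M x * w x <= p x.
      by rewrite mulrC -ler_pdivlMr// ge_min lexx orbT.
    have := w0 x; have := g0 x; have := f0 x; have := M0 x.
    rewrite -EFinD lee_fin; case: (leP (g x - M x) 0) => h *; nra.
  rewrite ge0_integralD//; first last.
  - exact/measurable_EFinP.
  - by move=> x _; rewrite lee_fin ltW.
  by rewrite ipc EFinD leeD.
by apply: (hardy_of_unit_ball hE mw w0 _ key); lra.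
Qed.

End SubcriticalHardy.

(** * Access to the relaxed form through neighbourhoods *)

Section Relaxation.
Context {R : realType} {d : measure_display} {X : measurableType d}.
Variable mu : {measure set X -> \bar R}.
Variable E : (X -> R) -> \bar R.
Hypothesis hE : nonlinear_dirichlet_form mu E.
Implicit Types f g h : X -> R.
Local Notation L2 := (L2 mu).
Local Notation Ee := (Ee mu E).

Lemma Ee_ge0 f : (0 <= Ee f)%E.
Proof.
(* The supremum runs over a nonempty family: the empty set with radius 1 is an index, and its
   infimum is nonnegative. *)
apply: le_trans (ereal_sup_ubound _).
  2: { exists (set0, 1) => //=; split => //; split; first exact: measurable0.
       by rewrite measure0 ltry. }
by apply: le_ereal_inf_tmp => _ [g [g2 _] <-]; exact: (E_ge0 hE).
Qed.

Lemma Ee_le (C : \bar R) f :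
  (forall A (e dl : R), finite_measure_set mu A -> 0 < e -> 0 < dl ->
    exists g, [/\ L2 g, lcm_nbhd mu f A e g & (E g <= C + dl%:E)%E]) ->
  (Ee f <= C)%E.
Proof.
move=> H; apply: ge_ereal_sup => _ [[A e] /= [finA e0] <-].
apply/lee_addgt0Pr => dl dl0; have [g [g2 gA Eg]] := H A e dl finA e0 dl0.
by apply: le_trans Eg; apply: ereal_inf_lbound; exists g.
Qed.

Lemma Ee_lt (C : \bar R) f A (e : R) : (Ee f < C)%E -> finite_measure_set mu A -> 0 < e ->
  exists g, [/\ L2 g, lcm_nbhd mu f A e g & (E g < C)%E].
Proof.
move=> fC finA e0.
have : (ereal_inf [set E g | g in [set g | L2 g /\ lcm_nbhd mu f A e g]] < C)%E.
  by apply: le_lt_trans fC; apply: ereal_sup_ubound; exists (A, e).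
by move=> /ereal_inf_lt[_ [g [g2 gA] <-] Eg]; exists g.
Qed.

Lemma Ee_null_kernel f : measurable_fun setT f ->
  (forall l : R, 0 < l -> Ee (fun x => l * f x) = 0%E) ->
  MofEe mu E f /\ luxnorm_e mu E f = 0%E.
Proof.
move=> mf H; split.
  split=> //; apply/cvge_at_rightP => u [u0 _].
  by under eq_fun do rewrite H//; exact: cvg_cst.
apply/eqP; rewrite eq_le; apply/andP; split.
  apply/lee_addgt0Pr => l l0; rewrite add0e; apply: ereal_inf_lbound.
  by exists l => //; split => //; rewrite H// invr_gt0.
by apply: le_ereal_inf_tmp => _ [l [l0 _] <-]; rewrite lee_fin ltW.
Qed.

(** Continuity from above at the empty set, in the form needed to pick one index at which an
    exceptional set is small. *)
Lemma nonincreasing_mu_lt (F : nat -> set X) (e : R) : 0 < e -> (mu (F 0%N) < +oo)%E ->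
  (forall n, measurable (F n)) -> nonincreasing_seq F ->
  (forall x, exists n, ~ F n x) -> \forall n \near \oo, (mu (F n) < e%:E)%E.
Proof.
move=> e0 F0 mF niF F_.
have cF : \bigcap_n F n = set0.
  apply/seteqP; split=> // x Fx; have [n] := F_ x; apply; exact: Fx.
have := nonincreasing_cvg_mu F0 mF _ niF; rewrite cF measure0 => /(_ measurable0).
by apply: near_cvge_lt; rewrite lte_fin.
Qed.

End Relaxation.

(** * Bounded energy with infinite supremum produces a kernel element *)

Section InfiniteSupremum.
Context {R : realType} {d : measure_display} {X : measurableType d}.
Variable mu : {measure set X -> \bar R}.
Variable E : (X -> R) -> \bar R.
Hypothesis hE : nonlinear_dirichlet_form mu E.
Implicit Types f g h : X -> R.
Local Notation L2 := (L2 mu).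
Local Notation Ee := (Ee mu E).

(* [E] stays bounded along [G], so the truncations [min (l G_N / k) l], whose energy
   is at most [l C / k], converge to [l] times the indicator of [sup G = +oo]. *)
Lemma kernel_sup_infty (C : R) (G : nat -> X -> R) (H : X -> \bar R) :
  (forall n, L2 (G n)) -> (forall n x, 0 <= G n x <= G n.+1 x) ->
  (forall n, E (G n) <= C%:E)%E ->
  (forall x, (G n x)%:E @[n --> \oo] --> H x) -> measurable_fun setT H ->
  forall l : R, 0 < l -> Ee (fun x => l * \1_[set x | H x = +oo%E] x) = 0%E.
Proof.
move=> G2 Gnd EG GH mH l l0; apply/eqP; rewrite eq_le (Ee_ge0 hE) andbT.
have C0 : 0 <= C by rewrite -lee_fin; apply: le_trans (EG 0%N); exact: (E_ge0 hE).
have homoG x : {homo G^~ x : m n / (m <= n)%N >-> m <= n}.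
  by apply/nondecreasing_seqP => n; case/andP: (Gnd n x).
have GleH n x : ((G n x)%:E <= H x)%E.
  have := ereal_nondecreasing_cvgn (u_ := fun n => (G n x)%:E).
  move=> /(_ _)-/(_ (fun m n mn => homoG x _ _ mn)) cv.
  rewrite (cvg_unique _ (GH x) cv)//; by apply: ereal_sup_ubound; exists n.
have mB : measurable [set x | H x = +oo%E].
  rewrite (_ : [set x | _] = setT `&` H @^-1` [set +oo%E]); last by rewrite setTI.
  by apply: mH => //; exact: emeasurable_set1.
apply: Ee_le => A e dl [mA finA] e0 dl0.
have mG n : measurable_fun setT (G n) by case: (G2 n).
(* Where [H] is finite the limit is 0 and the truncation is at most l H / k, so it exceeds e only on
   [V k]. This control is uniform in the index of [G]. *)
pose V k := (A `&` ~` [set x | H x = +oo%E]) `&` [set x | (k%:R * e / l)%:E < H x]%E.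
have mV k : measurable (V k).
  apply: measurableI; first by apply: measurableI => //; exact: measurableC.
  by rewrite -[X in measurable X]setTI; exact: emeasurable_fun_o_infty.
have V_lt : \forall k \near \oo, (mu (V k) < (e / 2)%:E)%E.
  apply: nonincreasing_mu_lt => //; first lra.
  - by apply: le_lt_trans finA; apply: le_measure; rewrite ?inE// => x [[]].
  - move=> m n mn; apply/subsetPset => x [[Ax Bx] /= h]; split=> //=; apply: le_lt_trans h.
    by rewrite lee_fin ler_pM2r ?invr_gt0// ler_pM2r// ler_nat.
  - move=> x; have [Bx|Bx] := pselect (H x = +oo%E).
      by exists 0%N => -[[]].
    have [r r0 Hr] : exists2 r : R, 0 <= r & H x = r%:E.
      apply: ge0_lty_EFin.
        by apply: le_trans (GleH 0%N x); rewrite lee_fin; case/andP: (Gnd 0%N x).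
      by rewrite ltey; apply/eqP.
    have [n hn] : exists n : nat, r * l / e < n%:R.
      by exists (Num.bound (r * l / e)); apply: archi_boundP; rewrite divr_ge0 ?mulr_ge0 ?(ltW l0) ?(ltW e0).
    exists n => -[_ /=]; rewrite Hr lte_fin.
    move: hn; rewrite ltr_pdivrMr// ltr_pdivrMr//; lra.
(* [k] is fixed before the index of [G]. It has to make [V k] small, bring the energy bound l C / k
   below [dl], and give l / k <= 1, so that convexity applies to the scaling. *)
have [k [Vk kC1 kC2 k0]] : exists k, [/\ (mu (V k) < (e / 2)%:E)%E,
    l * k%:R^-1 * C <= dl, l * k%:R^-1 <= 1 & 0 < k%:R :> R].
  case: V_lt => N _ VN; pose k := (N + Num.bound (l * C / dl) + Num.bound l).+1.
  have k0 : 0 < k%:R :> R by [].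
  have b1 : l * C / dl < (Num.bound (l * C / dl))%:R.
    by apply: archi_boundP; rewrite divr_ge0 ?mulr_ge0 ?(ltW l0) ?(ltW dl0).
  have b2 : l < (Num.bound l)%:R by apply: archi_boundP; exact: ltW.
  have k1 : (Num.bound (l * C / dl))%:R <= k%:R :> R.
    by rewrite ler_nat /k; lia.
  have k2 : (Num.bound l)%:R <= k%:R :> R by rewrite ler_nat /k; lia.
  exists k; split=> //.
  - by apply: VN => /=; rewrite /k; lia.
  - rewrite mulrAC ler_pdivrMr//; move: b1; rewrite ltr_pdivrMr// => b1.
    by apply: (le_trans (ltW b1)); rewrite mulrC ler_pM2l.
  - by rewrite ler_pdivrMr// mul1r; apply: le_trans k2; exact: ltW.
(* Where [H] is infinite the truncation equals its limit l as soon as G_n >= k; [U n] is the part of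
   A where this still fails. *)
pose U n := (A `&` [set x | H x = +oo%E]) `&` [set x | (G n x < k%:R)%R].
have mU n : measurable (U n).
  apply: measurableI; first by apply: measurableI.
  rewrite (_ : [set x | _] = setT `&` (fun x => G n x < k%:R) @^-1` [set true]); last by rewrite setTI.
  by apply: measurable_fun_ltr.
have [n Un] : exists n, (mu (U n) < (e / 2)%:E)%E.
  have : \forall n \near \oo, (mu (U n) < (e / 2)%:E)%E.
    apply: nonincreasing_mu_lt => //; first lra.
    - by apply: le_lt_trans finA; apply: le_measure; rewrite ?inE// => x [[]].
    - move=> m n mn; apply/subsetPset => x [[Ax Bx] /= h]; split=> //=; apply: le_lt_trans h.
      exact: homoG.
    - move=> x; have [Bx|Bx] := pselect (H x = +oo%E); last by exists 0%N => -[[]].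
      have := GH x; rewrite Bx => /cvgeryP /cvgryPge /(_ k%:R)[N _ /(_ N (leqnn N))] /= h.
      by exists N => -[_ /=]; lra.
  by case=> N _ /(_ N (leqnn N)); exists N.
pose phi x := Num.min ((l * k%:R^-1) * G n x) l.
have lG2 : L2 (fun x => (l * k%:R^-1) * G n x) by exact: L2Z.
have lk0 : 0 < l * k%:R^-1 by rewrite mulr_gt0// invr_gt0.
exists phi; split.
- have [mlG _] := lG2; apply: (L2_dom lG2) => [|x]; first by rewrite /phi; meas.
  have Gx0 : 0 <= l * k%:R^-1 * G n x by rewrite mulr_ge0 ?(ltW lk0)//; case/andP: (Gnd n x).
  by rewrite /phi !ger0_norm//; [rewrite ge_min lexx|rewrite le_min Gx0/= ltW].
- rewrite /lcm_nbhd /=.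
  apply: (@le_lt_trans _ _ (mu (V k `|` U n))).
    apply: le_measure; rewrite ?inE.
    + apply: measurableI => //.
      rewrite (_ : [set x | _] = setT `&` (fun x => e < `|phi x - l * \1_[set x | H x = +oo%E] x|) @^-1` [set true]); last by rewrite setTI.
      apply: measurable_fun_ltr => //.
      by rewrite /phi; meas; first exact: mG; exact: measurable_indic.
    + exact: measurableU.
    + move=> x [Ax /=]; rewrite indicE /phi.
      have Gx0 : 0 <= G n x by case/andP: (Gnd n x).
      have [Bx|Bx] := pselect (H x = +oo%E).
        rewrite mem_set//= mulr1 => h; right; split=> //=; rewrite ltNge; apply/negP => kG.
        move: h; rewrite min_r; first by rewrite subrr normr0; lra.
        by rewrite -mulrA ler_peMr ?(ltW l0)// mulrC ler_pdivlMr// mul1r.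
      rewrite memNset//= mulr0 subr0 => h; left; split=> //=; apply: lt_le_trans (GleH n x).
      rewrite lte_fin ltr_pdivrMr//.
      have : e < l * k%:R^-1 * G n x.
        move: h; rewrite ger0_norm; first by rewrite lt_min => /andP[].
        by rewrite le_min (ltW l0) andbT mulr_ge0// ltW.
      by rewrite mulrAC ltr_pdivlMr//; lra.
  apply: le_lt_trans (measureU2 _ _ _) _ => //.
  by rewrite [e]splitr EFinD lteD.
- rewrite add0e; apply: (le_trans (E_min hE (ltW l0) lG2)).
  apply: (le_trans (E_scale hE (G2 n) _)); first by rewrite (ltW lk0).
  apply: (@le_trans _ _ ((l * k%:R^-1)%:E * C%:E)%E); last by rewrite -EFinM lee_fin.
  by rewrite lee_wpmul2l// lee_fin ltW.
Qed.
End InfiniteSupremum.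

(** * From a trivial kernel to the weighted inequality *)

Section HardyWeight.
Context {R : realType} {d : measure_display} {X : measurableType d}.
Variable mu : {measure set X -> \bar R}.
Variable E : (X -> R) -> \bar R.
Hypothesis hE : nonlinear_dirichlet_form mu E.
Implicit Types f g h : X -> R.
Local Notation L2 := (L2 mu).
Variable p : X -> R.
Hypotheses (mp : measurable_fun setT p) (p0 : forall x, 0 < p x).
Variable c : R.
Hypothesis ipc : (\int[mu]_x (p x)%:E = c%:E)%E.

Let D g := [/\ L2 g, forall x, 0 <= g x & (E g < +oo)%E].
(** This is s / (1 + s), written with a single reciprocal; its values lie in [0, 1] for s >= 0,
    whence 0 <= F <= c. *)
Let psi (s : R) := 1 - (1 + s)^-1.
Let F g : \bar R := (\int[mu]_x (p x * psi (g x))%:E)%E.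
Let J g : R := fine (F g) - fine (E g).

Let psi_ge0 s : 0 <= s -> 0 <= psi s.
Proof. by move=> s0; rewrite subr_ge0 invf_le1; lra. Qed.

Let psi_le1 s : 0 <= s -> psi s <= 1.
Proof. by move=> s0; rewrite lerBlDr lerDl invr_ge0; lra. Qed.

(* Tangent inequality for the concave [psi], with the derivative at [s] replaced by a
   lower bound depending only on [r]. *)
Let psi_tangent (s g t r : R) : 0 <= s -> 0 <= g -> 0 < t -> t <= 1 -> 1 + s <= r ->
  psi s + t * (g * (r^-1 * (r + t * g)^-1)) <= psi (t * g + (1 - t) * s) + t.
Proof.
move=> s0 g0 t0 t1 sr; set k := t * g + (1 - t) * s.
have tg0 : 0 <= t * g by rewrite mulr_ge0// ltW.
have ts0 : 0 <= t * s by rewrite mulr_ge0// ltW.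
have k0 : 0 <= k by rewrite addr_ge0// mulr_ge0// subr_ge0.
have A0 : 0 < (1 + s)^-1 by rewrite invr_gt0; lra.
have B0 : 0 < (1 + k)^-1 by rewrite invr_gt0; lra.
have A1 : (1 + s)^-1 * (1 + s) = 1 by rewrite mulVf// gt_eqF//; lra.
have B1 : (1 + k)^-1 * (1 + k) = 1 by rewrite mulVf// gt_eqF//; lra.
have rA : r^-1 <= (1 + s)^-1 by rewrite lef_pV2 ?posrE; lra.
have rB : (r + t * g)^-1 <= (1 + k)^-1 by rewrite lef_pV2 ?posrE; try lra; rewrite /k; lra.
have Bl1 : (1 + k)^-1 <= 1 by rewrite invf_le1; lra.
have h1 : r^-1 * (r + t * g)^-1 <= (1 + s)^-1 * (1 + k)^-1.
  by apply: ler_pM => //; rewrite invr_ge0; lra.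
rewrite /psi; move: A0 B0 A1 B1 h1 Bl1.
set A := (1 + s)^-1; set B := (1 + k)^-1; set Q := r^-1 * _ => A0 B0 A1 B1 h1 Bl1.
(* A - B = A B (k - s) with k - s = t (g - s). The g part is the gain. The s part costs at most t,
   since A s = 1 - A <= 1 and B <= 1; this is the extra t in the conclusion. *)
have h2 : A - B = t * g * (A * B) - t * (A * B * s).
  have -> : A - B = A * (B * (1 + k)) - B * (A * (1 + s)) by rewrite A1 B1 !mulr1.
  by rewrite /k; ring.
have h3 : t * g * Q <= t * g * (A * B) by rewrite ler_wpM2l.
have h4 : t * (A * B * s) <= t.
  rewrite ler_piMr ?(ltW t0)// mulrAC; have -> : A * s = 1 - A by rewrite -A1; ring.
  by rewrite mulr_ile1 ?(ltW B0)//; [rewrite subr_ge0 /A invf_le1; lra|lra].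
lra.
Qed.

Let mpsi g : measurable_fun setT g -> (forall x, 0 <= g x) ->
  measurable_fun setT (fun x => p x * psi (g x)).
Proof.
move=> mg g0; rewrite /psi; meas; apply: measurable_funV; first by meas.
by move=> x; have := g0 x; lra.
Qed.

Let ppsi_ge0 g x : (forall x, 0 <= g x) -> 0 <= p x * psi (g x).
Proof. by move=> g0; rewrite mulr_ge0 ?psi_ge0// ltW. Qed.

Let F_fin g : measurable_fun setT g -> (forall x, 0 <= g x) ->
  [/\ F g = (fine (F g))%:E, 0 <= fine (F g) & fine (F g) <= c].
Proof.
move=> mg g0.
have F0 : (0 <= F g)%E by apply: integral_ge0_EFin => x; exact: ppsi_ge0.
have Fc : (F g <= c%:E)%E.
  rewrite -ipc; apply: le_integral_EFin => //; [exact: mpsi|by move=> x; exact: ppsi_ge0|].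
  by move=> x; rewrite ler_piMr ?psi_le1// ltW.
have Fy : (F g < +oo)%E by apply: le_lt_trans Fc _; exact: ltry.
have Ff : F g \is a fin_num by rewrite ge0_fin_numE.
by rewrite -!lee_fin !fineK.
Qed.

Let E_fin g : D g -> E g = (fine (E g))%:E /\ 0 <= fine (E g).
Proof.
move=> [g2 _ Ey]; have E0 := E_ge0 hE g2.
have Ef : E g \is a fin_num by rewrite ge0_fin_numE.
by rewrite fineK// fine_ge0.
Qed.

Let D_max f g : D f -> D g -> D (fun x => Num.max (f x) (g x)).
Proof.
move=> [f2 f0 Ef] [g2 g0 Eg]; split; first exact: L2_max.
  by move=> x; rewrite le_max f0.
by apply: le_lt_trans (E_max hE f2 g2) _; rewrite lte_add_pinfty.
Qed.

Let D_min f g : D f -> D g -> D (fun x => Num.min (f x) (g x)).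
Proof.
move=> [f2 f0 Ef] [g2 g0 Eg]; split; first exact: L2_min.
  by move=> x; rewrite le_min f0 g0.
apply: (@le_lt_trans _ _ (E f + E g)%E); last by rewrite lte_add_pinfty.
apply: le_trans (E_submodular hE f2 g2).
by rewrite leeDr// (E_ge0 hE)//; exact: L2_max.
Qed.

(** The integral part is modular, because maximum and minimum only permute the two values at each
    point; the form contributes submodularity with a minus sign. *)
Let J_supermodular f g : D f -> D g ->
  J f + J g <= J (fun x => Num.max (f x) (g x)) + J (fun x => Num.min (f x) (g x)).
Proof.
move=> Df Dg; have DM := D_max Df Dg; have Dm := D_min Df Dg.
case: (Df) (Dg) (DM) (Dm) => f2 f0 _ [g2 g0 _] [M2 M0 _] [m2 m0 _].
have := E_submodular hE f2 g2.
have [-> _] := E_fin Df; have [-> _] := E_fin Dg.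
have [-> _] := E_fin DM; have [-> _] := E_fin Dm.
have [mf _] := f2; have [mg _] := g2; have [mM _] := M2; have [mm _] := m2.
have : (F f + F g = F (fun x => Num.max (f x) (g x)) + F (fun x => Num.min (f x) (g x)))%E.
  rewrite /F -!integralD_ge0_EFin; try solve [exact: mpsi|by move=> x; first [exact: (ppsi_ge0 x f0)|exact: (ppsi_ge0 x g0)|exact: (ppsi_ge0 x M0)|exact: (ppsi_ge0 x m0)]].
  apply: eq_integral => x _; congr (_%:E).
  by case: (leP (f x) (g x)) => _ //; rewrite addrC.
have [-> _ _] := F_fin mf f0; have [-> _ _] := F_fin mg g0.
have [-> _ _] := F_fin mM M0; have [-> _ _] := F_fin mm m0.
rewrite -!EFinD lee_fin => -[h1] h2; rewrite /J; lra.
Qed.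

Let D0 : D (fun=> 0).
Proof. by split=> //; [exact: L2_0|rewrite (E_0 hE) ltry]. Qed.

Let S := sup [set J g | g in D].

Let has_supJ : has_sup [set J g | g in D].
Proof.
split; first by exists (J (fun=> 0)); exists (fun=> 0) => //; exact: D0.
exists c => _ [g Dg <-]; case: (Dg) => -[mg _] g0 _.
have [_ _ Fc] := F_fin mg g0; have [_ E0] := E_fin Dg; rewrite /J; lra.
Qed.

Let J_le_S g : D g -> J g <= S.
Proof. by move=> Dg; apply: ub_le_sup; [case: has_supJ|exists g]. Qed.

Let S_ge0 : 0 <= S.
Proof.
apply: le_trans (J_le_S D0); rewrite /J (E_0 hE)/= subr0.
by have [] := @F_fin (fun=> 0) (measurable_cst _) (fun=> lexx _).
Qed.

Lemma kernel_trivial_weight :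
  (forall f, MofEe mu E f -> luxnorm_e mu E f = 0%E -> {ae mu, forall x, f x = 0}) ->
  exists w : X -> R, [/\ measurable_fun setT w, forall x, 0 < w x &
    forall g, L2 g -> (forall x, 0 <= g x) -> (E g <= 1)%E ->
      (\int[mu]_x (g x * w x)%:E <= (c + 2)%:E)%E].
Proof.
move=> ker0.
have /choice[gs Hgs] : forall n, exists g, D g /\ S - (4^-1) ^+ n < J g.
  move=> n.
  have e0 : 0 < (4^-1 : R) ^+ n by rewrite exprn_gt0// invr_gt0.
  by have [_ [g Dg <-] h] := sup_adherent e0 has_supJ; exists g.
have Dgs n : D (gs n) by case: (Hgs n).
have Jgs n : S - (4^-1) ^+ n < J (gs n) by case: (Hgs n).
pose G := fix G N := if N is N'.+1 then (fun x => Num.max (G N' x) (gs N'.+1 x)) else gs 0%N.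
have DG N : D (G N) by elim: N => [|N IH] /=; [exact: Dgs|exact: D_max].
(* Since J of the minimum is at most [S], taking the maximum with the next function loses at most
   its defect 4^-(N+1). The surplus 4^-N in the bound pays for the next loss and closes the
   induction. *)
have JG N : S - 2 + (4^-1) ^+ N <= J (G N).
  elim: N => [|N IH] /=.
    by have := Jgs 0%N; rewrite expr0; lra.
  have := J_supermodular (DG N) (Dgs N.+1); have := J_le_S (D_min (DG N) (Dgs N.+1)).
  have := Jgs N.+1; have : 0 < (4^-1 : R) ^+ N by rewrite exprn_gt0// invr_gt0.
  by rewrite exprS; lra.
(* E = F - J with F <= c, J >= S - 2 and S >= 0. *)
have EG N : (E (G N) <= (c + 2)%:E)%E.
  have [-> _] := E_fin (DG N); case: (DG N) => -[mG _] G0 _.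
  have [_ _ Fc] := F_fin mG G0; rewrite lee_fin; have := JG N; rewrite /J.
  have : 0 < (4^-1 : R) ^+ N by rewrite exprn_gt0// invr_gt0.
  have := S_ge0; lra.
have Gnd N x : 0 <= G N x <= G N.+1 x.
  by case: (DG N) => _ -> _ /=; rewrite le_max lexx.
have homoG x : {homo G^~ x : m n / (m <= n)%N >-> m <= n}.
  by apply/nondecreasing_seqP => n; case/andP: (Gnd n x).
pose H x : \bar R := ereal_sup (range (fun N => (G N x)%:E)).
have GH x : (G n x)%:E @[n --> \oo] --> H x.
  by apply: ereal_nondecreasing_cvgn => m n mn; rewrite lee_fin; exact: homoG.
have mG N : measurable_fun setT (G N) by case: (DG N) => -[].
have mH : measurable_fun setT H.
  apply: (emeasurable_fun_cvg (fun N x => (G N x)%:E)) => [N|x _]; last exact: GH.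
  exact/measurable_EFinP.
have gsH n x : ((gs n x)%:E <= H x)%E.
  apply: (@le_trans _ _ (G n x)%:E); last by apply: ereal_sup_ubound; exists n.
  by case: n => [|n] /=; rewrite lee_fin// le_max lexx orbT.
have mB : measurable [set x | H x = +oo%E].
  rewrite (_ : [set x | _] = setT `&` H @^-1` [set +oo%E]); last by rewrite setTI.
  by apply: mH => //; exact: emeasurable_set1.
have G2 N : L2 (G N) by case: (DG N).
have Hfin : {ae mu, forall x, H x = (fine (H x))%:E}.
  have k0 := kernel_sup_infty hE G2 Gnd EG GH mH.
  have mI : measurable_fun setT (\1_[set x | H x = +oo%E] : X -> R) by exact: measurable_indic.
  have [M0 l0] := Ee_null_kernel mI k0.
  apply: filterS (ker0 _ M0 l0) => x; rewrite indicE.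
  have [Hx|Hx] := pselect (H x = +oo%E).
    by rewrite mem_set//= => /eqP; rewrite oner_eq0.
  move=> _; rewrite fineK// ge0_fin_numE; first by rewrite ltey; apply/eqP.
  by apply: le_trans (gsH 0%N x); rewrite lee_fin; case: (Dgs 0%N).
(* All members of the maximizing sequence lie below [H], so [r] bounds 1 + gs_n for every n at once,
   wherever [H] is finite. *)
pose r x := 1 + fine (H x).
have r1 x : 1 <= r x.
  rewrite lerDl fine_ge0//; apply: le_trans (gsH 0%N x); rewrite lee_fin; by case: (Dgs 0%N).
have mr : measurable_fun setT r.
  by apply: measurable_funD => //; apply: measurableT_comp.
have r0 x : 0 < r x by apply: lt_le_trans (r1 x).
have mrV : measurable_fun setT (fun x => (r x)^-1) by exact: measurable_funV.
exists (fun x => p x * ((r x)^-1 * (r x)^-1)); split; first by meas.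
  by move=> x; rewrite !mulr_gt0 ?invr_gt0.
move=> g g2 g0 Eg; have [mg _] := g2.
have Dg : D g by split=> //; apply: le_lt_trans Eg _; exact: ltry.
pose t n : R := 2^-1 ^+ n.
have t0 n : 0 < t n by rewrite exprn_gt0// invr_gt0.
have t1 n : t n <= 1 by rewrite exprn_ile1//; lra.
pose q n x := p x * g x * ((r x)^-1 * (r x + t n * g x)^-1).
have rt0 n x : 0 < r x + t n * g x by rewrite ltr_pwDl// mulr_ge0// ltW.
have q0 n x : 0 <= q n x by rewrite !mulr_ge0 ?invr_ge0 ?(ltW (r0 _)) ?(ltW (rt0 _ _)) ?(ltW (p0 _)).
have mq n : measurable_fun setT (q n).
  rewrite /q; meas; apply: measurable_funV => //; by meas.
have iq n : (\int[mu]_x (q n x)%:E <= (c + 2)%:E)%E.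
  (* The variation moves from gs_n a fraction t_n of the way towards g. Convexity of [E] bounds the
     energy along the segment, so no derivative of [E] is needed. *)
  pose k x := t n * g x + (1 - t n) * gs n x.
  have [gsn2 gsn0 _] := Dgs n; have [mgs _] := gsn2.
  have k2 : L2 k by apply: L2D; exact: L2Z.
  have k0 x : 0 <= k x by rewrite addr_ge0// mulr_ge0// ?subr_ge0// ltW.
  have mk : measurable_fun setT k by case: k2.
  have tn01 : 0 <= t n <= 1 by rewrite (ltW (t0 n)) t1.
  have Ek : (E k <= (t n)%:E * E g + (1 - t n)%:E * E (gs n))%E by exact: (E_convex hE).
  have [Eg1 Eg0] := E_fin Dg; have [Es1 Es0] := E_fin (Dgs n).
  rewrite Eg1 Es1 -!EFinM -EFinD in Ek.
  have Dk : D k by split=> //; apply: le_lt_trans Ek _; exact: ltry.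
  have [Ek1 Ek0] := E_fin Dk; rewrite Ek1 lee_fin in Ek.
  rewrite Eg1 lee_fin in Eg.
  have Jk := J_le_S Dk; have Js := Jgs n.
  have [Fk1 _ _] := F_fin mk k0; have [Fs1 _ _] := F_fin mgs gsn0.
  have int : (F (gs n) + (t n)%:E * \int[mu]_x (q n x)%:E <= F k + (t n)%:E * \int[mu]_x (p x)%:E)%E.
    have tn0 := ltW (t0 n).
    rewrite -!integralZl_ge0_EFin//; last by move=> x; exact: ltW.
    rewrite /F -!integralD_ge0_EFin; first last.
    all: try solve [by meas|exact: mpsi|by move=> x; first [exact: (ppsi_ge0 x k0)|exact: (ppsi_ge0 x gsn0)]|by move=> x; rewrite mulr_ge0// ltW].
    apply: ae_ge0_le_integral => //.
    - by move=> x _; rewrite lee_fin addr_ge0 ?ppsi_ge0// mulr_ge0.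
    - by apply/measurable_EFinP; apply: measurable_funD; [exact: mpsi|meas].
    - by move=> x _; rewrite lee_fin addr_ge0 ?ppsi_ge0// mulr_ge0// ltW.
    - by apply/measurable_EFinP; apply: measurable_funD; [exact: mpsi|meas].
    apply: filterS Hfin => x Hx _; rewrite lee_fin.
    have sr : 1 + gs n x <= r x by rewrite /r lerD2l -lee_fin -Hx.
    have := ler_wpM2l (ltW (p0 x)) (psi_tangent (gsn0 x) (g0 x) (t0 n) (t1 n) sr).
    rewrite -/(k x) /q.
    move: (p x) (g x) (t n) (psi (gs n x)) (psi (k x)) (r x)^-1 (r x + t n * g x)^-1.
    by move=> *; lra.
  rewrite Fk1 Fs1 ipc in int.
  have iq0 : (0 <= \int[mu]_x (q n x)%:E)%E by exact: integral_ge0_EFin.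
  (* The defect 4^-n is t_n^2: after division by t_n the estimate reads at most c + E(g) + t_n,
     hence at most c + 2. *)
  have t4 : (4^-1 : R) ^+ n = t n * t n.
    by rewrite /t -exprMn; congr (_ ^+ _); rewrite -invfM; congr (_^-1); ring.
  move: int iq0; case: (\int[mu]_x _)%E => [i| |]//.
    rewrite -!EFinM -!EFinD !lee_fin => int iq0.
    have := t0 n; have := t1 n; move: Jk Js; rewrite /J t4 => Jk Js t1n t0n.
    rewrite -(ler_pM2l t0n); nra.
  by rewrite gt0_muley ?lte_fin// addey// -EFinM -EFinD leye_eq.
(* As t_n tends to 0, the integrand q_n tends to p g / r^2, which is g times the chosen weight. *)
apply: (@fatou_le _ _ _ mu (fun n x => (q n x)%:E)) => //.
- by move=> n; exact/measurable_EFinP.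
- by meas.
- by move=> x; rewrite lee_fin !mulr_ge0 ?invr_ge0 ?(ltW (r0 _)) ?(ltW (p0 _)).
- apply: aeW => x.
  have : (q n x)%:E @[n --> \oo] --> (p x * g x * ((r x)^-1 * (r x + 0 * g x)^-1))%:E.
    apply: cvg_EFin; first exact: nearW.
    apply: cvgMr; apply: cvgMr; apply: cvgV; first by rewrite mul0r addr0 gt_eqF.
    apply: cvgD; first exact: cvg_cst.
    apply: cvgMl; rewrite /t; apply: cvg_expr; rewrite ger0_norm; lra.
  move=> /cvg_limn_einf_sup[-> _]; rewrite mul0r addr0 lee_fin.
  by rewrite -!mulrA mulrCA.
- exact: nearW.
Qed.
End HardyWeight.

Lemma kernel_trivial_hardy (R : realType) (d : measure_display) (X : measurableType d)
  (mu : {measure set X -> \bar R}) (E : (X -> R) -> \bar R) :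
  sigma_finite setT mu -> nonlinear_dirichlet_form mu E ->
  (forall f, MofEe mu E f -> luxnorm_e mu E f = 0%E -> {ae mu, forall x, f x = 0}) ->
  exists w : X -> R, measurable_fun setT w /\ (forall x, 0 < w x) /\
    forall f, MofE mu E f -> (\int[mu]_x (`|f x| * w x)%:E <= luxnorm E f)%E.
Proof.
move=> /sigma_finite_weight[p [mp p0 p1 ip]] hE ker0.
have ip0 : (0 <= \int[mu]_x (p x)%:E)%E by apply: integral_ge0_EFin => x; exact: ltW.
have [c c0 ipc] := ge0_lty_EFin ip0 ip.
have [w [mw w0 hw]] := kernel_trivial_weight hE mp p0 ipc ker0.
by apply: (hardy_of_unit_ball hE mw w0 _ hw); lra.
Qed.

(** * Sums of lower limits, and almost everywhere convergence from summable increments *)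

Section AlmostEverywhereLimits.
Context {R : realType} {d : measure_display} {X : measurableType d}.
Variable mu : {measure set X -> \bar R}.

Lemma limn_einfD_ge0 (u v : nat -> \bar R) : (forall n, 0 <= u n)%E ->
  (forall n, 0 <= v n)%E ->
  (limn_einf u + limn_einf v <= limn_einf (fun n => u n + v n))%E.
Proof.
move=> u0 v0; have einfs_ge0 (w : nat -> \bar R) n : (forall n, 0 <= w n)%E -> (0 <= einfs w n)%E.
  by move=> w0; apply: le_ereal_inf_tmp => _ [m _ <-].
rewrite !limn_einf_lim -limeD; [|exact: is_cvg_einfs|exact: is_cvg_einfs|]; last first.
  by apply: ge0_adde_def; rewrite inE; apply: lime_ge; try exact: is_cvg_einfs;
     apply: nearW => n; exact: einfs_ge0.
apply: lee_lim; [|exact: is_cvg_einfs|].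
  apply: is_cvgeD; [|exact: is_cvg_einfs|exact: is_cvg_einfs].
  by apply: ge0_adde_def; rewrite inE; apply: lime_ge; try exact: is_cvg_einfs;
     apply: nearW => n; exact: einfs_ge0.
apply: nearW => n; apply: le_ereal_inf_tmp => _ [m nm <-].
by apply: leeD; apply: ereal_inf_lbound; exists m.
Qed.

Lemma series_half_le (C : R) : 0 <= C ->
  (\sum_(0 <= i <oo) ((C * 2^-1 ^+ i)%:E : \bar R) <= (2 * C)%:E)%E.
Proof.
move=> C0; have := @epsilon_trick0 R (2 * C) xpredT.
rewrite mulr_ge0// => /(_ isT).
by under eq_eseriesr do rewrite natrX exprS invfM mulrACA divff// mul1r -exprVn.
Qed.

(** The weighted sum of the increments has finite integral, so it is finite almost everywhere;
    dividing by p > 0, the telescoping series converges absolutely there. Completeness, both for L^2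
    minimizing sequences and for the Luxemburg norm, rests on this. *)
Lemma ae_cvg_weighted_L1 (p : X -> R) (g : nat -> X -> R) (C : R) :
  measurable_fun setT p -> (forall x, 0 < p x) ->
  (forall n, measurable_fun setT (g n)) -> 0 <= C ->
  (forall n, \int[mu]_x (`|g n.+1 x - g n x| * p x)%:E <= (C * 2^-1 ^+ n)%:E)%E ->
  exists u : X -> R, measurable_fun setT u /\ {ae mu, forall x, g n x @[n --> \oo] --> u x}.
Proof.
move=> mp p0 mg C0 ig.
pose s n x : \bar R := (`|g n.+1 x - g n x| * p x)%:E.
have s0 n x : (0 <= s n x)%E by rewrite lee_fin mulr_ge0// ltW.
have ms n : measurable_fun setT (s n) by rewrite /s; meas.
have S0 x : (0 <= \sum_(0 <= n <oo) s n x)%E by apply: nneseries_ge0.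
have Sy : {ae mu, forall x, (\sum_(0 <= n <oo) s n x < +oo)%E}.
  apply: integral_lty_ae => //; first by apply: ge0_emeasurable_sum.
  rewrite integral_nneseries//.
  apply: (@le_lt_trans _ _ (2 * C)%:E); last exact: ltry.
  apply: le_trans (series_half_le C0); apply: lee_nneseries => [i _ _|i _]; last exact: ig.
  by apply: integral_ge0 => x _.
(* The upper limit is measurable without reference to the null set and equals the limit wherever one
   exists. *)
exists (fun x => fine (limn_esup (fun n => (g n x)%:E))); split.
  apply: measurableT_comp => //; apply: measurable_fun_limn_esup => n.
  exact/measurable_EFinP.
apply: filterS Sy => x Sx.
have gx : cvgn (g ^~ x).
  have : cvgn [normed series (telescope (g ^~ x))].
    apply: nondecreasing_is_cvgn.
      by apply: nondecreasing_series => n _ _; exact: normr_ge0.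
    have [r r0 Sr] := ge0_lty_EFin (S0 x) Sx.
    exists (r / p x) => _ [n _ <-]; rewrite ler_pdivlMr// -lee_fin -Sr.
    rewrite (_ : (_ * p x)%:E = (\sum_(0 <= i < n) s i x)%E).
      by apply: nneseries_lim_ge => i _ _; exact: s0.
    by rewrite sumEFin -mulr_suml.
  move=> /normed_cvg/cvg_ex[l hl]; have -> : g ^~ x = (fun n => g 0%N x + series (telescope (g ^~ x)) n).
    by apply/funext => n; exact: eq_sum_telescope.
  by apply/cvg_ex; exists (g 0%N x + l); apply: cvgD; [exact: cvg_cst|exact: hl].
have := gx; rewrite /= => /cvg_ex[l gl].
have : (g n x)%:E @[n --> \oo] --> l%:E by apply: cvg_EFin => //; exact: nearW.
by move=> /cvg_limn_einf_sup[_ ->].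
Qed.

End AlmostEverywhereLimits.

(** * Existence of nonnegative resolvents *)

Section ResolventExistence.
Context {R : realType} {d : measure_display} {X : measurableType d}.
Variable mu : {measure set X -> \bar R}.
Variable E : (X -> R) -> \bar R.
Hypothesis hE : nonlinear_dirichlet_form mu E.
Implicit Types f g h : X -> R.
Local Notation L2 := (L2 mu).

(* The parallelogram identity makes every minimizing sequence Cauchy in [L^2]. *)
Lemma quadratic_perturbation_minimizer (b : R) h : sigma_finite setT mu -> 0 < b -> L2 h ->
  exists u, L2 u /\ forall g, L2 g ->
    (E u + b%:E * dist2sq mu u h <= E g + b%:E * dist2sq mu g h)%E.
Proof.
move=> /sigma_finite_weight[p [mp p0 p1 ip]] b0 h2.
pose Phi g := (E g + b%:E * dist2sq mu g h)%E.
have Phi0 g : L2 g -> (0 <= Phi g)%E.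
  by move=> g2; rewrite adde_ge0 ?(E_ge0 hE)// mule_ge0 ?dist2sq_ge0// lee_fin ltW.
pose I := ereal_inf [set Phi g | g in L2].
have I0 : (0 <= I)%E by apply: le_ereal_inf_tmp => _ [g g2 <-]; exact: Phi0.
have Iy : (I < +oo)%E.
  apply: (@le_lt_trans _ _ (Phi (fun=> 0))).
    by apply: ereal_inf_lbound; exists (fun=> 0) => //; exact: L2_0.
  by rewrite /Phi (E_0 hE) add0e lte_mul_pinfty ?lee_fin ?(ltW b0)//; exact: dist2sq_lty (L2_0 mu) h2.
have [i i0 Ii] := ge0_lty_EFin I0 Iy.
have q0 n : 0 < (4^-1 : R) ^+ n by rewrite exprn_gt0// invr_gt0.
have /choice[g Hg] : forall n, exists g, L2 g /\ (Phi g < (i + 4^-1 ^+ n)%:E)%E.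
  move=> n; have : (I < (i + 4^-1 ^+ n)%:E)%E by rewrite Ii lte_fin; have := q0 n; lra.
  by move=> /ereal_inf_lt[_ [g g2 <-] h']; exists g.
have g2 n : L2 (g n) by case: (Hg n).
have mg n : measurable_fun setT (g n) by case: (g2 n).
have mh : measurable_fun setT h by case: h2.
(* For the midpoint k, convexity and the parallelogram identity give i <= Phi(k) <= i + 4^-n - (b /
   4) d(g_n, g_m), where d is the squared distance; this yields the factor 4 / b. *)
pose K := 4 / b.
have K0 : 0 <= K by rewrite divr_ge0// ltW.
have gcauchy n m : (n <= m)%N -> (dist2sq mu (g n) (g m) <= (K * 4^-1 ^+ n)%:E)%E.
  move=> nm; pose k x := 2^-1 * g n x + (1 - 2^-1) * g m x.
  have k2 : L2 k by apply: L2D; exact: L2Z.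
  have mk : measurable_fun setT k by case: k2.
  have h01 : 0 <= (2^-1 : R) <= 1 by lra.
  have Ek := E_convex hE (g2 n) (g2 m) h01; rewrite -/k in Ek.
  have Ik : (I <= Phi k)%E by apply: ereal_inf_lbound; exists k.
  have par : (dist2sq mu k h + (4^-1)%:E * dist2sq mu (g n) (g m) =
      (2^-1)%:E * dist2sq mu (g n) h + (2^-1)%:E * dist2sq mu (g m) h)%E.
    have k4 : 0 <= (4^-1 : R) by lra.
    have k2' : 0 <= (2^-1 : R) by lra.
    rewrite /dist2sq -!integralZl_ge0_EFin//; try solve [by meas|by move=> x; exact: sqr_ge0].
    rewrite -!integralD_ge0_EFin; try solve [by meas|by move=> x; exact: sqr_ge0|by move=> x; rewrite mulr_ge0// sqr_ge0].
    by apply: eq_integral => x _; congr (_%:E); rewrite /k; lra.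
  have q4 : (4^-1 : R) ^+ m <= 4^-1 ^+ n by apply: ler_wiXn2l => //; lra.
  have [_ Pn] := Hg n; have [_ Pm] := Hg m.
  move: par Ek Ik Pn Pm; rewrite /Phi Ii.
  have := E_ge0 hE (g2 n); have := E_ge0 hE (g2 m); have := E_ge0 hE k2.
  have [d1 _ ->] := ge0_lty_EFin (dist2sq_ge0 mu _ _) (dist2sq_lty k2 h2).
  have [d2 _ ->] := ge0_lty_EFin (dist2sq_ge0 mu _ _) (dist2sq_lty (g2 n) h2).
  have [d3 _ ->] := ge0_lty_EFin (dist2sq_ge0 mu _ _) (dist2sq_lty (g2 m) h2).
  have [d4 _ ->] := ge0_lty_EFin (dist2sq_ge0 mu _ _) (dist2sq_lty (g2 n) (g2 m)).
  case: (E k) => [e1| |]//; case: (E (g m)) => [e2| |]//; case: (E (g n)) => [e3| |]//.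
  rewrite -!EFinM -!EFinD !lee_fin !lte_fin => _ _ _ [par] Ek Ik Pn Pm.
  by rewrite /K -mulrA mulrCA -ler_pdivrMl ?invr_gt0// invrK; nra.
have ip0 : (0 <= \int[mu]_x (p x)%:E)%E by apply: integral_ge0_EFin => x; exact: ltW.
have [c c0 ipc] := ge0_lty_EFin ip0 ip.
have half4 n : (2 : R) ^+ n * 4^-1 ^+ n = 2^-1 ^+ n.
  by rewrite -exprMn; congr (_ ^+ _); lra.
have [u [mu' gu]] : exists u : X -> R, measurable_fun setT u /\ {ae mu, forall x, g n x @[n --> \oo] --> u x}.
  apply: (@ae_cvg_weighted_L1 _ _ _ mu p g (K + c)) => //; first by rewrite addr_ge0.
  (* Young's inequality with factor 2^n, together with p^2 <= p, trades the squared distance K 4^-n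
     for a weighted L^1 bound (K + c) 2^-n. The whole sequence therefore converges almost
     everywhere. *)
  move=> n; apply: (@le_trans _ _ (\int[mu]_x (2 ^+ n * (g n x - g n.+1 x) ^+ 2 + 2^-1 ^+ n * p x)%:E)%E).
    apply: le_integral_EFin; [by meas|by meas|by move=> x; rewrite mulr_ge0// ltW|].
    move=> x; have t0 : 0 < (2 : R) ^+ n by rewrite exprn_gt0.
    rewrite distrC exprVn -(real_normK (num_real (g n x - g n.+1 x))).
    have := normr_ge0 (g n x - g n.+1 x); have := p0 x; have := p1 x.
    have : 2 ^+ n * (2 ^+ n)^-1 = 1 :> R by rewrite divff ?gt_eqF.
    have : 0 < ((2 : R) ^+ n)^-1 by rewrite invr_gt0.
    move: t0; move: (2 ^+ n) (2 ^+ n)^-1 `|_| (p x) => t s y q t0 s0 ts q1 q00 y0.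
    have : 0 <= s * (t * y - q) ^+ 2 by rewrite mulr_ge0 ?sqr_ge0// ltW.
    have -> : s * (t * y - q) ^+ 2 = (t * s) * (t * y ^+ 2) - 2 * (t * s) * (y * q) + s * q ^+ 2 by ring.
    have : s * q ^+ 2 <= s * q by rewrite ler_wpM2l ?(ltW s0)// expr2 ler_piMl// ltW.
    have : 0 <= y * q by rewrite mulr_ge0// ltW.
    rewrite ts; lra.
  have n2 : 0 <= (2 : R) ^+ n by rewrite exprn_ge0.
  have n2' : 0 <= (2^-1 : R) ^+ n by rewrite exprn_ge0.
  rewrite integralD_ge0_EFin; try solve [by meas|by move=> x; rewrite mulr_ge0// ?sqr_ge0// ltW].
  rewrite !integralZl_ge0_EFin//; try solve [by meas|by move=> x; exact: sqr_ge0|by move=> x; exact: ltW].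
  rewrite ipc mulrDl EFinD -!EFinM (mulrC c) leeD2r//.
  apply: (@le_trans _ _ ((2 ^+ n)%:E * (K * 4^-1 ^+ n)%:E)%E).
    by rewrite lee_wpmul2l ?lee_fin//; exact: (gcauchy n n.+1).
  by rewrite -EFinM lee_fin mulrCA half4.
(* Fatou in the second index of the Cauchy estimate upgrades almost everywhere convergence to
   convergence in L^2, which lower semicontinuity of [E] requires. *)
have gu2 n : (dist2sq mu (g n) u <= (K * 4^-1 ^+ n)%:E)%E.
  apply: (@fatou_le _ _ _ mu (fun m x => ((g n x - g m x) ^+ 2)%:E)).
  - by move=> m; meas.
  - by move=> m x; rewrite lee_fin sqr_ge0.
  - by meas.
  - by move=> x; rewrite lee_fin sqr_ge0.
  - apply: filterS gu => x gx.
    have : ((g n x - g m x) ^+ 2)%:E @[m --> \oo] --> ((g n x - u x) ^+ 2)%:E.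
      apply: cvg_EFin; first exact: nearW.
      by apply: cvgM; apply: cvgB => //; exact: cvg_cst.
    by move=> /cvg_limn_einf_sup[-> _].
  - by exists n => // m /= nm; exact: gcauchy.
have u2 : L2 u.
  have du : L2 (fun x => g 0%N x - u x).
    split; first by meas.
    by apply: le_lt_trans (gu2 0%N) _; exact: ltry.
  have := L2B (g2 0%N) du; congr (L2 _); apply/funext => x; ring.
have q_cvg : (4^-1 : R) ^+ n @[n --> \oo] --> 0.
  by apply: cvg_expr; rewrite ger0_norm; lra.
exists u; split=> // f f2.
apply: (@le_trans _ _ I); last by apply: ereal_inf_lbound; exists f.
have lscE : (E u <= limn_einf (fun n => E (g n)))%E.
  apply: (E_lsc hE) => //.
  apply: (@squeeze_cvge _ _ _ _ (cst 0%E) _ (fun n => (K * 4^-1 ^+ n)%:E)).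
  - by apply: nearW => n; rewrite dist2sq_ge0 gu2.
  - exact: cvg_cst.
  - apply: cvg_EFin; first exact: nearW.
    by rewrite /= -[X in _ --> X](mulr0 K); apply: cvgM => //; exact: cvg_cst.
have lscD : (b%:E * dist2sq mu u h <= limn_einf (fun n => b%:E * dist2sq mu (g n) h))%E.
  have bE g' : measurable_fun setT g' ->
      (b%:E * dist2sq mu g' h = \int[mu]_x (b * (g' x - h x) ^+ 2)%:E)%E.
    by move=> mg'; rewrite integralZl_ge0_EFin//; [by meas|exact: ltW|by move=> x; exact: sqr_ge0].
  rewrite bE// (_ : (fun n => _) = fun n => \int[mu]_x (b * (g n x - h x) ^+ 2)%:E)%E; last first.
    by apply/funext => n; rewrite bE.
  have b0' := ltW b0.
  apply: (@fatou_ae _ _ _ mu (fun n x => (b * (g n x - h x) ^+ 2)%:E)).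
  - by move=> n; meas.
  - by move=> n x; rewrite lee_fin mulr_ge0// sqr_ge0.
  - by meas.
  - by move=> x; rewrite lee_fin mulr_ge0// sqr_ge0.
  - apply: filterS gu => x gx.
    have : (b * (g m x - h x) ^+ 2)%:E @[m --> \oo] --> (b * (u x - h x) ^+ 2)%:E.
      apply: cvg_EFin; first exact: nearW.
      by apply: cvgM; [exact: cvg_cst|apply: cvgM; apply: cvgB => //; exact: cvg_cst].
    by move=> /cvg_limn_einf_sup[-> _].
apply: le_trans (leeD lscE lscD) _; apply: le_trans (limn_einfD_ge0 _ _) _.
- by move=> n; exact: (E_ge0 hE).
- by move=> n; rewrite mule_ge0 ?dist2sq_ge0// lee_fin ltW.
apply/lee_addgt0Pr => e e0; apply: limn_einf_le.
have : \forall n \near \oo, (4^-1 : R) ^+ n <= e by apply: (cvgr_le 0).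
apply: filterS => n qe; have [_ /ltW Pn] := Hg n; apply: le_trans Pn _.
by rewrite Ii -EFinD lee_fin; lra.
Qed.

(** Replacing a minimizer by its absolute value increases neither the energy nor the distance to f /
    a, because f / a >= 0. *)
Lemma resolvent_exists (a : R) f : sigma_finite setT mu -> 0 < a -> L2 f ->
  (forall x, 0 <= f x) -> exists u, is_resolvent mu E a f u /\ forall x, 0 <= u x.
Proof.
move=> sf a0 f2 f0.
have [u [u2 umin]] := quadratic_perturbation_minimizer sf (divr_gt0 a0 (ltr0n _ 2)) (L2Z a^-1 f2).
exists (fun x => `|u x|); split=> //; split; first exact: L2_norm.
move=> g g2; apply: le_trans (umin _ g2); apply: leeD; first exact: (E_norm hE).
have [mu' _] := u2; have [mf _] := f2.
apply: lee_wpmul2l; first by rewrite lee_fin; lra.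
apply: le_integral_EFin; [by meas|by meas|by move=> x; exact: sqr_ge0|].
move=> x; have : 0 <= a^-1 * f x by rewrite mulr_ge0// invr_ge0 ltW.
by move: (a^-1 * f x) => y y0; case: (ger0P (u x)) => // h; nra.
Qed.

End ResolventExistence.

(** * Monotonicity of resolvents and finiteness of the Green potential *)

Section GreenOperator.
Context {R : realType} {d : measure_display} {X : measurableType d}.
Variable mu : {measure set X -> \bar R}.
Variable E : (X -> R) -> \bar R.
Hypothesis hE : nonlinear_dirichlet_form mu E.
Implicit Types f g h : X -> R.
Local Notation L2 := (L2 mu).

(* The minimization property with the square expanded; the terms are distributed so that
   no subtraction of extended reals occurs. *)
Lemma resolvent_expanded (a : R) f u g : 0 < a -> L2 f -> (forall x, 0 <= f x) ->
  is_resolvent mu E a f u -> (forall x, 0 <= u x) -> L2 g -> (forall x, 0 <= g x) ->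
  (E u + (a / 2)%:E * \int[mu]_x (u x ^+ 2)%:E + \int[mu]_x (f x * g x)%:E <=
   E g + (a / 2)%:E * \int[mu]_x (g x ^+ 2)%:E + \int[mu]_x (f x * u x)%:E)%E.
Proof.
move=> a0 f2 f0 ru u0 g2 g0; have Eu := resolvent_E_lty hE a0 f2 ru.
case: ru => u2 /(_ _ g2) umin.
have [mf if2] := f2; have [mu' iu2] := u2; have [mg ig2] := g2.
have ah : 0 <= a / 2 by lra.
have ah' : 0 <= (2 * a)^-1 by rewrite invr_ge0; lra.
(* The square is expanded with the mixed term moved to the left; the remaining f^2 / (2 a) does not
   involve v and cancels between the two competitors. *)
have sq (v : X -> R) : measurable_fun setT v -> (forall x, 0 <= v x) ->
    ((a / 2)%:E * dist2sq mu v (fun x => (a^-1 * f x)%R) + \int[mu]_x (f x * v x)%:E =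
    (a / 2)%:E * \int[mu]_x (v x ^+ 2)%:E + ((2 * a)^-1)%:E * \int[mu]_x (f x ^+ 2)%:E)%E.
  move=> mv v0.
  rewrite /dist2sq -!integralZl_ge0_EFin//; try solve [by meas|by move=> x; exact: sqr_ge0].
  rewrite -!integralD_ge0_EFin; try solve [by meas|by move=> x; rewrite mulr_ge0 ?sqr_ge0].
  apply: eq_integral => x _; congr (_%:E).
  by field; rewrite gt_eqF.
have := sq _ mu' u0; have := sq _ mg g0; move: umin Eu.
have := E_ge0 hE u2; have := E_ge0 hE g2.
have [d1 _ ->] := ge0_lty_EFin (dist2sq_ge0 mu _ _) (dist2sq_lty u2 (L2Z a^-1 f2)).
have [d2 _ ->] := ge0_lty_EFin (dist2sq_ge0 mu _ _) (dist2sq_lty g2 (L2Z a^-1 f2)).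
have fv0 (v : X -> R) : (forall x, 0 <= v x) -> (0 <= \int[mu]_x (f x * v x)%:E)%E.
  by move=> v0; apply: integral_ge0_EFin => x; rewrite mulr_ge0.
have [d3 _ ->] := ge0_lty_EFin (fv0 u u0) (integral_L2_mul_lty f2 u2 f0 u0).
have [d4 _ ->] := ge0_lty_EFin (fv0 g g0) (integral_L2_mul_lty f2 g2 f0 g0).
have sq0 (v : X -> R) : (0 <= \int[mu]_x (v x ^+ 2)%:E)%E.
  by apply: integral_ge0_EFin => x; exact: sqr_ge0.
have [d5 _ ->] := ge0_lty_EFin (sq0 f) if2.
have [d6 _ ->] := ge0_lty_EFin (sq0 u) iu2.
have [d7 _ ->] := ge0_lty_EFin (sq0 g) ig2.
case: (E u) => [e1| |]//; case: (E g) => [e2| |]//; last by move=> *; rewrite /= leey.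
rewrite -!EFinM -!EFinD !lee_fin => _ _ H _ [H1] [H2]; lra.
Qed.

Lemma cvg_le_limn_einf (v : nat -> \bar R) (l : \bar R) : (forall n, v n <= l)%E ->
  (l <= limn_einf v)%E -> v @ \oo --> l.
Proof.
move=> vl lv; rewrite -(oppeK l) (_ : v = -%E \o (-%E \o v)); last first.
  by apply/funext => n /=; rewrite oppeK.
apply: cvgeN; have := @limn_esup_le_cvg _ (-%E \o v) (- l)%E.
apply; last by move=> n /=; rewrite leeN2.
by rewrite limn_esupN leeN2.
Qed.

Lemma integral_sqr_max_min f g : measurable_fun setT f -> measurable_fun setT g ->
  (\int[mu]_x (Num.max (f x) (g x) ^+ 2)%:E + \int[mu]_x (Num.min (f x) (g x) ^+ 2)%:E =
   \int[mu]_x (f x ^+ 2)%:E + \int[mu]_x (g x ^+ 2)%:E)%E.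
Proof.
move=> mf mg; rewrite -!integralD_ge0_EFin; try solve [by meas|by move=> x; exact: sqr_ge0].
by apply: eq_integral => x _; congr (_%:E); case: (leP (f x) (g x)) => _ //; rewrite addrC.
Qed.

(* Test [u1] against [min u1 u2] and [u2] against [max u1 u2] and add: by submodularity
   only the quadratic terms survive, and they force [min u1 u2 = u1]. *)
Lemma resolvent_antitone (a1 a2 : R) f u1 u2 : 0 < a2 -> a2 < a1 -> L2 f ->
  (forall x, 0 <= f x) ->
  is_resolvent mu E a1 f u1 -> (forall x, 0 <= u1 x) ->
  is_resolvent mu E a2 f u2 -> (forall x, 0 <= u2 x) ->
  {ae mu, forall x, u1 x <= u2 x}.
Proof.
move=> a20 a21 f2 f0 r1 u10 r2 u20; have a10 : 0 < a1 by lra.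
pose M x := Num.max (u1 x) (u2 x); pose m x := Num.min (u1 x) (u2 x).
have [u12 _] := r1; have [u22 _] := r2.
have M2 : L2 M by exact: L2_max.
have m2 : L2 m by exact: L2_min.
have M0 x : 0 <= M x by rewrite le_max u10.
have m0 x : 0 <= m x by rewrite le_min u10 u20.
have [mf _] := f2; have [m1 i1] := u12; have [m2' i2] := u22.
have [mM iM] := M2; have [mm im] := m2.
have H1 := resolvent_expanded a10 f2 f0 r1 u10 m2 m0.
have H2 := resolvent_expanded a20 f2 f0 r2 u20 M2 M0.
have H3 := E_submodular hE u12 u22.
have H4 := integral_sqr_max_min m1 m2'.
have H5 : (\int[mu]_x (f x * M x)%:E + \int[mu]_x (f x * m x)%:E =
   \int[mu]_x (f x * u1 x)%:E + \int[mu]_x (f x * u2 x)%:E)%E.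
  rewrite -!integralD_ge0_EFin; try solve [by meas|by move=> x; rewrite mulr_ge0].
  apply: eq_integral => x _; congr (_%:E); rewrite /M /m.
  by case: (leP (u1 x) (u2 x)) => _ //; rewrite addrC.
have H6 : (\int[mu]_x (m x ^+ 2)%:E + \int[mu]_x (u1 x ^+ 2 - m x ^+ 2)%:E = \int[mu]_x (u1 x ^+ 2)%:E)%E.
  have le x : 0 <= u1 x ^+ 2 - m x ^+ 2.
    by rewrite subr_ge0 ler_sqr ?nnegrE// /m ge_min lexx.
  rewrite -integralD_ge0_EFin//; try solve [by meas|by move=> x; exact: sqr_ge0].
  by apply: eq_integral => x _; congr (_%:E); ring.
have fv0 (v : X -> R) : (forall x, 0 <= v x) -> (0 <= \int[mu]_x (f x * v x)%:E)%E.
  by move=> v0; apply: integral_ge0_EFin => x; rewrite mulr_ge0.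
have sq0 (v : X -> R) : (0 <= \int[mu]_x (v x ^+ 2)%:E)%E.
  by apply: integral_ge0_EFin => x; exact: sqr_ge0.
have le x : 0 <= u1 x ^+ 2 - m x ^+ 2.
  by rewrite subr_ge0 ler_sqr ?nnegrE// /m ge_min lexx.
suff Q0 : (\int[mu]_x (u1 x ^+ 2 - m x ^+ 2)%:E <= 0)%E.
  have mQ : measurable_fun setT (fun x => u1 x ^+ 2 - m x ^+ 2) by meas.
  apply: filterS (integral_eq0_ae mQ le Q0) => x.
  move=> /eqP; rewrite subr_eq0 eqrXn2// => /eqP ->; by rewrite /m ge_min lexx orbT.
have qle : (\int[mu]_x (u1 x ^+ 2 - m x ^+ 2)%:E < +oo)%E.
  by apply: le_lt_trans i1; rewrite -H6 leeDr.
move: H1 H2 H3 H4 H5 H6; rewrite -/M -/m.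
have := E_ge0 hE M2; have := E_ge0 hE m2.
have [e1 _ ->] := ge0_lty_EFin (E_ge0 hE u12) (resolvent_E_lty hE a10 f2 r1).
have [e2 _ ->] := ge0_lty_EFin (E_ge0 hE u22) (resolvent_E_lty hE a20 f2 r2).
have [d1 _ ->] := ge0_lty_EFin (fv0 u1 u10) (integral_L2_mul_lty f2 u12 f0 u10).
have [d2 _ ->] := ge0_lty_EFin (fv0 u2 u20) (integral_L2_mul_lty f2 u22 f0 u20).
have [d3 _ ->] := ge0_lty_EFin (fv0 M M0) (integral_L2_mul_lty f2 M2 f0 M0).
have [d4 _ ->] := ge0_lty_EFin (fv0 m m0) (integral_L2_mul_lty f2 m2 f0 m0).
have [d5 _ ->] := ge0_lty_EFin (sq0 u1) i1.
have [d6 _ ->] := ge0_lty_EFin (sq0 u2) i2.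
have [d7 _ ->] := ge0_lty_EFin (sq0 M) iM.
have [d8 _ ->] := ge0_lty_EFin (sq0 m) im.
have [q q0 ->] := ge0_lty_EFin (integral_ge0_EFin mu le) qle.
case: (E M) => [e3| |]//; case: (E m) => [e4| |]//.
rewrite -!EFinM -!EFinD !lee_fin => _ _ H1 H2 H3 [H4] [H5] [H6].
(* By the modular identity for squares, [q] is both the loss from u1 to m and the gain from u2 to M,
   so it appears with factor a1 / 2 once and with -a2 / 2 once. *)
have : (a1 - a2) * q <= 0 by nra.
by rewrite pmulr_rle0// subr_gt0.
Qed.

(** Write T for the integral of u w. Comparison of u with 0 gives E(u) <= T / 2, hence a Luxemburg
    norm of at most max(1, T / 2), and the weighted inequality gives T <= max(1, T / 2). The factor
    1/2 in the datum is what allows T to be absorbed. *)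
Lemma hardy_resolvent_bound (w : X -> R) (a : R) u : measurable_fun setT w ->
  (forall x, 0 < w x) -> L2 w ->
  (forall f, MofE mu E f -> (\int[mu]_x (`|f x| * w x)%:E <= luxnorm E f)%E) ->
  0 < a -> is_resolvent mu E a (fun x => 2^-1 * w x) u -> (forall x, 0 <= u x) ->
  (\int[mu]_x (u x * w x)%:E <= 1)%E.
Proof.
move=> mw w0 w2 hw a0 ru u0; have f2 := L2Z 2^-1 w2.
have f0 x : 0 <= 2^-1 * w x by rewrite mulr_ge0// ltW.
have [u2 _] := ru; have [mu' iu] := u2.
have Eu := resolvent_E_lty hE a0 f2 ru.
have := resolvent_expanded a0 f2 f0 ru u0 (L2_0 mu) (fun=> lexx _).
rewrite (E_0 hE) add0e.
under [X in (_ + X <= _)%E]eq_integral do rewrite mulr0.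
under [X in (_ <= _ * X + _)%E]eq_integral do rewrite expr0n/=.
rewrite !integral0 mule0 adde0 add0e.
under [X in (_ <= X)%E]eq_integral do rewrite -mulrA [w _ * _]mulrC.
rewrite integralZl_ge0_EFin; try solve [by meas|by move=> x; rewrite mulr_ge0// ltW].
have w0' x : 0 <= w x by exact: ltW.
have uw0 : (0 <= \int[mu]_x (u x * w x)%:E)%E by apply: integral_ge0_EFin => x; rewrite mulr_ge0.
have [T T0 HT] := ge0_lty_EFin uw0 (integral_L2_mul_lty u2 w2 u0 w0').
have [e e0 He] := ge0_lty_EFin (E_ge0 hE u2) Eu.
have [s s0 ->] := ge0_lty_EFin (integral_ge0_EFin mu (fun x => sqr_ge0 (u x))) iu.
rewrite HT He -!EFinM -!EFinD !lee_fin => H.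
have as0 : 0 <= a / 2 * s by rewrite mulr_ge0//; lra.
have eT : e <= 2^-1 * T by lra.
have := hw u (MofE_lty hE u2 Eu).
under eq_integral do rewrite ger0_norm//.
rewrite HT => hT; pose l := Num.max 1 (T / 2).
have l1 : 1 <= l by rewrite le_max lexx.
have lT : T / 2 <= l by rewrite le_max lexx orbT.
have : (luxnorm E u <= l%:E)%E.
  apply: ereal_inf_lbound; exists l => //; split; first by lra.
  apply: le_trans (E_scale hE u2 _) _.
    by rewrite invr_ge0 invf_le1; lra.
  rewrite He -EFinM lee_fin ler_pdivrMl; lra.
move=> /(le_trans hT); rewrite lee_fin /l; case: (leP 1 (T / 2)) => ?; lra.
Qed.

Lemma hardy_subcritical (w : X -> R) : sigma_finite setT mu -> measurable_fun setT w ->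
  (forall x, 0 < w x) ->
  (forall f, MofE mu E f -> (\int[mu]_x (`|f x| * w x)%:E <= luxnorm E f)%E) ->
  subcritical mu E.
Proof.
move=> sf mw w0 hw; have [p [mp p0 p1 ip]] := sigma_finite_weight sf.
(* Lowering the weight to at most p <= 1 puts it in L^2, so its resolvents exist directly and
   constant approximating sequences serve for the extended resolvent. *)
pose w' x := Num.min (w x) (p x).
have mw' : measurable_fun setT w' by rewrite /w'; meas.
have w'0 x : 0 < w' x by rewrite lt_min w0 p0.
have w'p x : w' x <= p x by rewrite ge_min lexx orbT.
have w'2 : L2 w'.
  split=> //; apply: le_lt_trans ip; apply: le_integral_EFin => //; first by meas.
    by move=> x; exact: sqr_ge0.
  by move=> x; have := w'0 x; have := w'p x; have := p1 x; nra.
have hw' f : MofE mu E f -> (\int[mu]_x (`|f x| * w' x)%:E <= luxnorm E f)%E.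
  move=> Mf; have [[mf _] _] := Mf; apply: le_trans (hw f Mf).
  apply: le_integral_EFin; [by meas|by meas|by move=> x; rewrite mulr_ge0// ltW|].
  by move=> x; rewrite ler_wpM2l// ge_min lexx.
pose f x := 2^-1 * w' x.
have f2 : L2 f by exact: L2Z.
have mf : measurable_fun setT f by case: f2.
have f0 x : 0 < f x by rewrite mulr_gt0// invr_gt0.
have f0' x : 0 <= f x by exact: ltW.
(* For a <= 0 the value zero is an arbitrary default. *)
have /choice[u Hu] : forall a : R, exists u, 0 < a -> is_resolvent mu E a f u /\ forall x, 0 <= u x.
  move=> a; have [a0|a0] := pselect (0 < a); last by exists (fun=> 0).
  by have [u hu] := resolvent_exists hE sf a0 f2 f0'; exists u.
have ru a : 0 < a -> is_resolvent mu E a f (u a) by move=> /Hu[].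
have u0 a : 0 < a -> forall x, 0 <= u a x by move=> /Hu[].
have u_anti a b : 0 < a -> a < b -> {ae mu, forall x, u b x <= u a x}.
  move=> a0 ab; have b0 : 0 < b by lra.
  exact: (resolvent_antitone a0 ab f2 f0' (ru _ b0) (u0 _ b0) (ru _ a0) (u0 _ a0)).
have iu a : 0 < a -> (\int[mu]_x (u a x * w' x)%:E <= 1)%E.
  by move=> a0; exact: (hardy_resolvent_bound mw' w'0 w'2 hw' a0 (ru _ a0) (u0 _ a0)).
pose t n : R := n.+1%:R^-1.
have t0 n : 0 < t n by rewrite invr_gt0.
have tlt n : t n.+1 < t n by rewrite ltf_pV2 ?posrE// ltr_nat.
have mut n : measurable_fun setT (u (t n)) by case: (ru _ (t0 n)) => -[].
(* The limit is defined along the fixed sequence t_n, so that only countably many null sets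
   enter. *)
pose W x : \bar R := ereal_sup (range (fun n => (u (t n) x)%:E)).
have und : {ae mu, forall x, forall n, u (t n) x <= u (t n.+1) x}.
  by apply: ae_foralln => n; exact: u_anti.
have uW : {ae mu, forall x, (u (t n) x)%:E @[n --> \oo] --> W x}.
  apply: filterS und => x ux; apply: ereal_nondecreasing_cvgn => m n mn; rewrite lee_fin.
  by move: m n mn; apply/nondecreasing_seqP.
exists f; split=> //; split=> //; exists W; split; last first.
  (* Since w' > 0, [G] is infinite wherever [W] is; but [G] is integrable by Fatou. *)
  pose G x : \bar R := limn_einf (fun n => (u (t n) x * w' x)%:E).
  have mG : measurable_fun setT G by apply: measurable_fun_limn_einf => n; meas; exact: mut.
  have q0 n x : (0 <= (u (t n) x * w' x)%:E)%E by rewrite lee_fin mulr_ge0// ?u0// ltW.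
  have G0 x : (0 <= G x)%E by apply: limn_einf_ge0.
  have iG : (\int[mu]_x G x < +oo)%E.
    apply: (@le_lt_trans _ _ 1%E); last exact: ltry.
    apply: (@fatou_le _ _ _ mu (fun n x => (u (t n) x * w' x)%:E)) => //.
    - by move=> n; meas; exact: mut.
    - by apply: aeW => x; exact: lexx.
    - by apply: nearW => n; exact: iu.
  apply: filterS2 uW (integral_lty_ae mG G0 iG) => x ux Gx.
  rewrite ltey; apply/eqP => Wx; move: Gx.
  suff -> : G x = +oo%E by rewrite ltxx.
  have := ux; rewrite Wx => /cvgeryP/cvgryPge h.
  suff /cvg_limn_einf_sup[] : (u (t n) x * w' x)%:E @[n --> \oo] --> +oo%E by [].
  apply/cvgeryP/cvgryPge => r.
  by apply: filterS (h (r / w' x)) => n; rewrite ler_pdivrMr.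
exists (fun a x => (u a x)%:E); split.
  move=> a a0; exists (fun=> f), (fun=> u a); split=> //; split; first by move=> _ x; rewrite f0' lexx.
  split; first by move=> x; exact: cvg_cst.
  split; first by move=> _; exact: ru.
  by apply: aeW => x; exact: cvg_cst.
move=> a a0 a_cvg.
(* An arbitrary sequence a_k is squeezed against t_n by monotonicity; the pairs (n, k) are
   countable, so one null set suffices for each sequence. *)
have lo : {ae mu, forall x, forall n k, a k < t n -> u (t n) x <= u (a k) x}.
  apply: ae_foralln => n; apply: ae_foralln => k.
  have [h|h] := pselect (a k < t n); last by apply: aeW => x /h.
  by apply: filterS (u_anti _ _ (a0 k) h) => x ux _.
have hi : {ae mu, forall x, forall n k, t n < a k -> u (a k) x <= u (t n) x}.
  apply: ae_foralln => n; apply: ae_foralln => k.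
  have [h|h] := pselect (t n < a k); last by apply: aeW => x /h.
  by apply: filterS (u_anti _ _ (t0 n) h) => x ux _.
have t_cvg : t n @[n --> \oo] --> (0 : R) by exact: cvg_harmonic.
apply: filterS3 lo hi uW => x lox hix ux.
have uaW k : ((u (a k) x)%:E <= W x)%E.
  have : \forall n \near \oo, t n < a k by apply: (cvgr_lt 0).
  case=> N _ /(_ N (leqnn N)) /= h; apply: (@le_trans _ _ (u (t N) x)%:E).
    by rewrite lee_fin; exact: hix.
  by apply: ereal_sup_ubound; exists N.
have Wu : (W x <= limn_einf (fun k => (u (a k) x)%:E))%E.
  apply: ge_ereal_sup => _ [n _ <-]; apply: limn_einf_ge.
  have : \forall k \near \oo, a k < t n by apply: (cvgr_lt 0).
  by apply: filterS => k /lox h; rewrite lee_fin.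
exact: cvg_le_limn_einf.
Qed.

End GreenOperator.

(** * Criteria for local convergence in measure *)

Section LocalMeasure.
Context {R : realType} {d : measure_display} {X : measurableType d}.
Variable mu : {measure set X -> \bar R}.
Implicit Types f g h : X -> R.

Lemma cvge0_le (v : nat -> \bar R) : (forall n, 0 <= v n)%E ->
  (forall e : R, 0 < e -> \forall n \near \oo, (v n <= e%:E)%E) -> v @ \oo --> 0%E.
Proof.
move=> v0 H; apply: limn_esup_le_cvg => //.
apply/lee_addgt0Pr => e e0; rewrite add0e.
rewrite -leeN2 -limn_einfN; apply: limn_einf_ge.
by apply: filterS (H e e0) => n; rewrite -[(v n <= _)%E]leeN2.
Qed.

Lemma measurable_dist_gt f g (e : R) : measurable_fun setT f -> measurable_fun setT g ->
  measurable [set x | e < `|f x - g x|].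
Proof.
move=> mf mg.
rewrite (_ : [set x | _] = setT `&` (fun x => e < `|f x - g x|) @^-1` [set true]); last by rewrite setTI.
by apply: measurable_fun_ltr => //; meas.
Qed.

Lemma measurable_ge_cst f (t : R) : measurable_fun setT f -> measurable [set x | t <= f x].
Proof.
move=> mf.
rewrite (_ : [set x | _] = setT `&` (fun x => t <= f x) @^-1` [set true]); last by rewrite setTI.
by apply: measurable_fun_ler => //; meas.
Qed.

Lemma markov_superlevel f (t : R) : measurable_fun setT f -> (forall x, 0 <= f x) -> 0 <= t ->
  (t%:E * mu [set x | (t <= f x)%R] <= \int[mu]_x (f x)%:E)%E.
Proof.
move=> mf f0 t0; have mS := measurable_ge_cst t mf.
rewrite -[X in mu X]setIT -integral_indic// -integralZl_ge0_EFin;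
  [|exact: measurable_indic|by []|by move=> x; rewrite indicE].
apply: le_integral_EFin => //.
- by meas; exact: measurable_indic.
- by move=> x; rewrite mulr_ge0.
- move=> x; rewrite indicE; have [h|h] := boolP (x \in _).
    by rewrite mulr1; move: h; rewrite inE.
  by rewrite mulr0.
Qed.

Lemma superlevel_finite_measure f (t : R) : measurable_fun setT f -> (forall x, 0 <= f x) ->
  0 < t -> (\int[mu]_x (f x)%:E < +oo)%E -> finite_measure_set mu [set x | t <= f x].
Proof.
move=> mf f0 t0 fy; split; first exact: measurable_ge_cst.
rewrite -(@lte_pmul2l _ t%:E)// ?lte_fin// gt0_muley ?lte_fin//.
exact: le_lt_trans (markov_superlevel mf f0 (ltW t0)) fy.
Qed.

(** The points of A that are bad infinitely often form a null set. As A has finite measure, the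
    unions of the tails of bad sets shrink to it in measure. *)
Lemma ae_cvg_loc_measure (g : nat -> X -> R) f : (forall n, measurable_fun setT (g n)) ->
  measurable_fun setT f -> {ae mu, forall x, g n x @[n --> \oo] --> f x} ->
  cvg_loc_measure mu g f.
Proof.
move=> mg mf gf A e [mA Ay] e0.
pose F n := A `&` [set x | e < `|g n x - f x|].
have mF n : measurable (F n) by apply: measurableI => //; exact: measurable_dist_gt.
have mU n : measurable (\bigcup_(k >= n) F k) by apply: bigcup_measurable => k _.
have F0 : mu (lim_sup_set F) = 0%E.
  apply: measure_negligible.
    by apply: bigcap_measurable => //; exists 0%N.
  apply: negligibleS gf => x Fx /= gx.
  have : \forall n \near \oo, `|f x - g n x| < e by apply: cvgr_dist_lt.
  case=> N _ hN; have [n Nn [_ /=]] := Fx N I.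
  by rewrite distrC => h; have := hN n Nn; rewrite /= => /(lt_trans h); rewrite ltxx.
have cv : mu (\bigcup_(k >= n) F k) @[n --> \oo] --> 0%E.
  rewrite -F0; apply: lim_sup_set_cvg => //.
  apply: le_lt_trans Ay; apply: le_measure; rewrite ?inE// => x [n _ []]//.
apply: (@squeeze_cvge _ _ _ _ (cst 0%E) _ (fun n => mu (\bigcup_(k >= n) F k))) => //.
  apply: nearW => n; rewrite measure_ge0/=; apply: le_measure; rewrite ?inE//; first exact: mF.
  by move=> x Fx; exists n => /=.
exact: cvg_cst.
Qed.

(** The weight may be arbitrarily small on A. The part of A where it is below 1 / (k + 1) has small
    measure for large k; on the rest Markov's inequality applies with level e / (k + 1). *)
Lemma weighted_L1_cvg_loc_measure (w : X -> R) (g : nat -> X -> R) f :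
  measurable_fun setT w -> (forall x, 0 < w x) ->
  (forall n, measurable_fun setT (g n)) -> measurable_fun setT f ->
  (fun n => \int[mu]_x (`|g n x - f x| * w x)%:E)%E @ \oo --> 0%E ->
  cvg_loc_measure mu g f.
Proof.
move=> mw w0 mg mf gf A e [mA Ay] e0; apply: cvge0_le => // dl dl0.
pose V k := A `\` [set x | k.+1%:R^-1 <= w x].
have mV k : measurable (V k) by apply: measurableD => //; exact: measurable_ge_cst.
have [k Vk] : exists k, (mu (V k) < (dl / 2)%:E)%E.
  have : \forall k \near \oo, (mu (V k) < (dl / 2)%:E)%E.
    apply: nonincreasing_mu_lt => //; first lra.
    - by apply: le_lt_trans Ay; apply: le_measure; rewrite ?inE// => x [].
    - move=> m n mn; apply/subsetPset => x [Ax h]; split=> //= h'; apply: h => /=.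
      by apply: le_trans h'; rewrite lef_pV2 ?posrE// ler_nat.
    - move=> x; exists (Num.bound (w x)^-1) => -[_]; apply => /=.
      rewrite -[leRHS]invrK lef_pV2 ?posrE ?invr_gt0//.
      have := archi_boundP (ltW (_ : 0 < (w x)^-1)); rewrite invr_gt0 => /(_ (w0 x)) h.
      by apply: (le_trans (ltW h)); rewrite ler_nat.
  by case=> N _ /(_ N (leqnn N)); exists N.
pose t := e * k.+1%:R^-1.
have t0 : 0 < t by rewrite mulr_gt0// invr_gt0.
have := near_cvge_lt (_ : 0 < (t * (dl / 2))%:E)%E gf.
rewrite lte_fin mulr_gt0//; last by lra.
move=> /(_ isT); apply: filterS => n ig.
pose q x := `|g n x - f x| * w x.
have mq : measurable_fun setT q by rewrite /q; meas.
have q0 x : 0 <= q x by rewrite mulr_ge0// ltW.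
have mS : measurable [set x | t <= q x] by exact: measurable_ge_cst.
apply: (@le_trans _ _ (mu (V k `|` [set x | (t <= q x)%R]))).
  apply: le_measure; rewrite ?inE.
  - by apply: measurableI => //; exact: measurable_dist_gt.
  - exact: measurableU.
  - move=> x [Ax /= h]; have [wx|wx] := leP k.+1%:R^-1 (w x); last first.
      by left; split=> //=; rewrite leNgt wx.
    by right; rewrite /= /q /t; apply: ler_pM => //; rewrite ?(ltW e0) ?(ltW h)// invr_ge0.
apply: le_trans (measureU2 _ _ _) _ => //.
rewrite [dl]splitr EFinD leeD ?(ltW Vk)//.
rewrite -(@lee_pmul2l _ t%:E) ?lte_fin//.
by apply: le_trans (markov_superlevel mq q0 (ltW t0)) _; rewrite -EFinM ltW.
Qed.

End LocalMeasure.

(** * Approximation, semicontinuity and convexity of the relaxed form *)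

Section RelaxedForm.
Context {R : realType} {d : measure_display} {X : measurableType d}.
Variable mu : {measure set X -> \bar R}.
Variable E : (X -> R) -> \bar R.
Hypothesis hE : nonlinear_dirichlet_form mu E.
Hypothesis sf : sigma_finite setT mu.
Implicit Types f g h : X -> R.
Local Notation L2 := (L2 mu).
Local Notation Ee := (Ee mu E).

Lemma Ee_le_E f : L2 f -> (Ee f <= E f)%E.
Proof.
move=> f2; apply: ge_ereal_sup => _ [[A e] /= [_ e0] <-].
apply: ereal_inf_lbound; exists f => //; split=> //; rewrite /lcm_nbhd /=.
rewrite (_ : [set x | _] = set0) ?setI0 ?measure0 ?lte_fin//.
by apply/seteqP; split=> // x /=; rewrite subrr normr0 => /lt_trans/(_ e0); rewrite ltxx.
Qed.

(* Borel-Cantelli turns neighbourhoods shrinking geometrically into almost everywhere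
   convergence. *)
Lemma Ee_ae_approx f (C : \bar R) : measurable_fun setT f -> (Ee f < C)%E ->
  exists g : nat -> X -> R, [/\ forall n, L2 (g n), forall n, (E (g n) < C)%E &
    {ae mu, forall x, g n x @[n --> \oo] --> f x}].
Proof.
move=> mf fC; have [p [mp p0 p1 ip]] := sigma_finite_weight sf.
(* These sets have finite measure and increase to the whole space, so each point lies in all of them
   from some index on; off the upper limit of the bad sets, |g_n - f| <= t_n eventually. *)
pose A n := [set x | n.+1%:R^-1 <= p x].
have finA n : finite_measure_set mu (A n).
  by apply: superlevel_finite_measure => // x; exact: ltW.
pose t n : R := 2^-1 ^+ n.
have t0 n : 0 < t n by rewrite exprn_gt0// invr_gt0.
have t_cvg : t n @[n --> \oo] --> (0 : R) by apply: cvg_expr; rewrite ger0_norm; lra.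
have /choice[g Hg] := fun n => Ee_lt fC (finA n) (t0 n).
exists g; split=> [n|n|]; [by case: (Hg n)|by case: (Hg n)|].
have mg n : measurable_fun setT (g n) by case: (Hg n) => -[].
pose F n := A n `&` [set x | t n < `|g n x - f x|].
have mF n : measurable (F n).
  by apply: measurableI; [case: (finA n)|exact: measurable_dist_gt].
have F0 : mu (lim_sup_set F) = 0%E.
  apply: lim_sup_set_cvg0 => //.
  apply: (@le_lt_trans _ _ (2 * 1 : R)%:E); last exact: ltry.
  apply: le_trans (series_half_le ler01); apply: lee_nneseries => // n _.
  by rewrite mul1r ltW//; case: (Hg n).
have mL : measurable (lim_sup_set F).
  by apply: bigcap_measurable => [|n _]; [exists 0%N|apply: bigcup_measurable => k _].
exists (lim_sup_set F); split=> // x /=; apply: contra_notP => /= Fx.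
have [N hN] : exists N, forall n, (N <= n)%N -> ~ F n x.
  apply/not_existsP => H; apply: Fx => N _; have /existsNP[n] := H N.
  by move=> /not_implyP[Nn /contrapT Fn]; exists n.
apply/cvgrPdist_le => e e0.
have te : \forall n \near \oo, t n <= e by apply: (cvgr_le 0).
have [b hb] : exists b : nat, (p x)^-1 < b%:R.
  by exists (Num.bound (p x)^-1); apply: archi_boundP; rewrite invr_ge0 ltW.
near=> n; rewrite distrC; apply: (@le_trans _ _ (t n)); last by near: n.
rewrite leNgt; apply/negP => h; apply: (hN n); first by near: n; exists N.
split=> //; rewrite /A /= -[leRHS]invrK lef_pV2 ?posrE ?invr_gt0//.
apply: (le_trans (ltW hb)); rewrite ler_nat; apply: leqW; near: n; by exists b.
Unshelve. all: by end_near. Qed.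

(** Once g_N is within e / 2 of f on A, every element of the e / 2 neighbourhood of g_N lies in the
    e neighbourhood of f, so a competitor for g_N is one for f. *)
Lemma Ee_lsc (g : nat -> X -> R) f (C : R) : (forall n, measurable_fun setT (g n)) ->
  measurable_fun setT f -> {ae mu, forall x, g n x @[n --> \oo] --> f x} ->
  (\forall n \near \oo, Ee (g n) <= C%:E)%E -> (Ee f <= C%:E)%E.
Proof.
move=> mg mf gf gC; apply: Ee_le => A e dl finA e0 dl0; have [mA _] := finA.
have e20 : 0 < e / 2 by lra.
have := near_cvge_lt (_ : 0 < (e / 2)%:E)%E (ae_cvg_loc_measure mg mf gf finA e20).
rewrite lte_fin => /(_ e20) gA.
have [N _ hN] : \forall n \near \oo, (mu (A `&` [set x | (e / 2 < `|g n x - f x|)%R]) < (e / 2)%:E)%E /\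
    (Ee (g n) <= C%:E)%E by apply: filterS2 gA gC.
have [An Cn] := hN N (leqnn N).
have Cdl : (Ee (g N) < (C + dl)%:E)%E by apply: le_lt_trans Cn _; rewrite lte_fin; lra.
have [k [k2 kA Ek]] := Ee_lt Cdl finA e20; have [mk _] := k2.
exists k; split=> //; last exact: ltW.
rewrite /lcm_nbhd /=.
pose U := A `&` [set x | e / 2 < `|k x - g N x|]; pose V := A `&` [set x | e / 2 < `|g N x - f x|].
have mU : measurable U by apply: measurableI => //; exact: measurable_dist_gt.
have mV : measurable V by apply: measurableI => //; exact: measurable_dist_gt.
apply: (@le_lt_trans _ _ (mu (U `|` V))).
  apply: le_measure; rewrite ?inE.
  - by apply: measurableI => //; exact: measurable_dist_gt.
  - exact: measurableU.
  - move=> x [Ax /= h]; have [hU|hU] := ltP (e / 2) `|k x - g N x|; first by left.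
    right; split=> //=; have := ler_distD (g N x) (k x) (f x); lra.
apply: le_lt_trans (measureU2 _ _ _) _ => //.
by rewrite [e]splitr EFinD lteD.
Qed.

(** Convexity passes from [E] through almost everywhere approximants of both functions and lower
    semicontinuity. The real bounds a and b avoid products with infinite energies. *)
Lemma Ee_convex f g (a b t : R) : measurable_fun setT f -> measurable_fun setT g ->
  0 <= t <= 1 -> (Ee f <= a%:E)%E -> (Ee g <= b%:E)%E ->
  (Ee (fun x => (t * f x + (1 - t) * g x)%R) <= (t * a + (1 - t) * b)%:E)%E.
Proof.
move=> mf mg t01 fa gb; apply/lee_addgt0Pr => dl dl0; rewrite -EFinD.
have fa' : (Ee f < (a + dl)%:E)%E by apply: le_lt_trans fa _; rewrite lte_fin; lra.
have gb' : (Ee g < (b + dl)%:E)%E by apply: le_lt_trans gb _; rewrite lte_fin; lra.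
have [u [u2 Eu uf]] := Ee_ae_approx mf fa'.
have [v [v2 Ev vg]] := Ee_ae_approx mg gb'.
have k2 n : L2 (fun x => t * u n x + (1 - t) * v n x) by apply: L2D; exact: L2Z.
apply: (@Ee_lsc (fun n x => t * u n x + (1 - t) * v n x)).
- by move=> n; case: (k2 n).
- by meas.
- apply: filterS2 uf vg => x ux vx.
  by apply: cvgD; apply: cvgM => //; exact: cvg_cst.
- apply: nearW => n; apply: le_trans (Ee_le_E (k2 n)) _.
  apply: le_trans (E_convex hE (u2 n) (v2 n) t01) _.
  case/andP: t01 => t0 t1.
  apply: (@le_trans _ _ (t%:E * (a + dl)%:E + (1 - t)%:E * (b + dl)%:E)%E).
    by apply: leeD; apply: lee_wpmul2l; rewrite ?lee_fin ?subr_ge0// ltW.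
  by rewrite -!EFinM -EFinD lee_fin; lra.
Qed.

Lemma Ee_cst0 : Ee (fun=> 0) = 0%E.
Proof.
apply/eqP; rewrite eq_le (Ee_ge0 hE) andbT -(E_0 hE); apply: Ee_le_E; exact: L2_0.
Qed.

Lemma Ee_scale f (a t : R) : measurable_fun setT f -> 0 <= t <= 1 -> (Ee f <= a%:E)%E ->
  (Ee (fun x => (t * f x)%R) <= (t * a)%:E)%E.
Proof.
move=> mf t01 fa.
have := @Ee_convex f (fun=> 0) a 0 t mf (measurable_cst _) t01 fa.
rewrite Ee_cst0 lexx => /(_ isT); rewrite mulr0 addr0.
rewrite (_ : (fun x => _) = (fun x => t * f x))//.
by apply/funext => x; rewrite addr0.
Qed.

Lemma luxnorm_e_ge0 f : (0 <= luxnorm_e mu E f)%E.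
Proof. by apply: le_ereal_inf_tmp => _ [l [l0 _] <-]; rewrite lee_fin ltW. Qed.

(** A strict inequality provides an admissible k < l, and scaling by k / l <= 1 keeps the relaxed
    energy below 1. *)
Lemma luxnorm_e_lt f (l : R) : measurable_fun setT f -> (luxnorm_e mu E f < l%:E)%E ->
  (Ee (fun x => (l^-1 * f x)%R) <= 1)%E.
Proof.
move=> mf /ereal_inf_lt[_ [k [k0 Ek] <-]]; rewrite lte_fin => kl.
have l0 : 0 < l by lra.
have mkf : measurable_fun setT (fun x => k^-1 * f x) by meas.
have t01 : 0 <= k / l <= 1 by rewrite divr_ge0 ?(ltW k0) ?(ltW l0)// ler_pdivrMr// mul1r ltW.
have := Ee_scale mkf t01 Ek.
rewrite (_ : (fun x => _) = (fun x => l^-1 * f x)); last first.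
  by apply/funext => x; field; rewrite !gt_eqF.
move=> /le_trans; apply; rewrite lee_fin mulr1; by case/andP: t01.
Qed.

(** Relaxed energy at most 1 only provides approximants of energy below 2; by convexity their
    Luxemburg norm is at most 2, which costs the factor 1/2 in the weight. *)
Lemma hardy_relaxed (w : X -> R) : measurable_fun setT w -> (forall x, 0 < w x) ->
  (forall f, MofE mu E f -> (\int[mu]_x (`|f x| * w x)%:E <= luxnorm E f)%E) ->
  forall f, measurable_fun setT f ->
    (\int[mu]_x (`|f x| * (2^-1 * w x))%:E <= luxnorm_e mu E f)%E.
Proof.
move=> mw w0 hw f mf; apply: le_ereal_inf_tmp => _ [l [l0 El] <-].
have mlf : measurable_fun setT (fun x => l^-1 * f x) by meas.
have El2 : (Ee (fun x => (l^-1 * f x)%R) < 2%:E)%E.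
  by apply: le_lt_trans El _; rewrite lte_fin; lra.
have [g [g2 Eg gf]] := Ee_ae_approx mlf El2.
have mg n : measurable_fun setT (g n) by case: (g2 n).
have q0 (v : X -> R) x : 0 <= `|v x| * w x by rewrite mulr_ge0// ltW.
have : (\int[mu]_x (`|l^-1 * f x| * w x)%:E <= 2%:E)%E.
  apply: (@fatou_le _ _ _ mu (fun n x => (`|g n x| * w x)%:E)).
  - by move=> n; meas.
  - by move=> n x; rewrite lee_fin.
  - by meas.
  - by move=> x; rewrite lee_fin (q0 (fun x => l^-1 * f x)).
  - apply: filterS gf => x gx.
    have : (`|g n x| * w x)%:E @[n --> \oo] --> (`|l^-1 * f x| * w x)%:E.
      apply: cvg_EFin; first exact: nearW.
      by apply: cvgM; [exact: cvg_norm|exact: cvg_cst].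
    by move=> /cvg_limn_einf_sup[-> _].
  - apply: nearW => n.
    have Egy : (E (g n) < +oo)%E by apply: lt_trans (Eg n) _; exact: ltry.
    apply: le_trans (hw _ (MofE_lty hE (g2 n) Egy)) _.
    apply: ereal_inf_lbound; exists 2 => //; split=> //.
    apply: le_trans (E_scale hE (g2 n) _) _; first by lra.
    by rewrite lee_pdivrMl// mule1 ltW.
rewrite (_ : (fun x => (`|l^-1 * f x| * w x)%:E) =
    (fun x => (2 / l * (`|f x| * (2^-1 * w x)))%:E)); last first.
  apply/funext => x; congr (_%:E); rewrite normrM gtr0_norm ?invr_gt0//.
  by field; rewrite gt_eqF.
rewrite integralZl_ge0_EFin; try solve [by meas|by move=> x; rewrite !mulr_ge0// ltW|by rewrite divr_ge0// ltW].
rewrite -lee_pdivlMl ?divr_gt0// -EFinM (_ : (2 / l)^-1 * 2 = l)//.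
by field; rewrite gt_eqF.
Qed.

(** Write v f as the midpoint of 2 v (f - g) and 2 v g: the first has energy at most 2 v by
    convexity, and the second tends to zero. This places a limit in the space without any prior
    bound on its own energy. *)
Lemma MofEe_perturb f g : measurable_fun setT f -> MofEe mu E g ->
  (Ee (fun x => (f x - g x)%R) <= 1)%E -> MofEe mu E f.
Proof.
move=> mf [mg Mg] fg; split=> //; apply/cvge_at_rightP => v [v0 v_cvg].
have v2_cvg : 2 * v n @[n --> \oo] --> (0 : R).
  by rewrite -(mulr0 2); apply: cvgM => //; exact: cvg_cst.
have Eg : Ee (fun x => 2 * v n * g x) @[n --> \oo] --> 0%E.
  move/cvge_at_rightP: Mg => /(_ (fun n => 2 * v n)); apply; split=> // n.
  by rewrite mulr_gt0.
have mfg : measurable_fun setT (fun x => f x - g x) by meas.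
apply: cvge0_le => [n|e e0]; first exact: (Ee_ge0 hE).
have v2e : \forall n \near \oo, 2 * v n <= e by apply: (cvgr_le 0).
have v21 : \forall n \near \oo, 2 * v n <= 1 by apply: (cvgr_le 0).
have Ege := near_cvge_lt (_ : 0 < e%:E)%E Eg.
rewrite lte_fin in Ege; have {}Ege := Ege e0.
apply: filterS3 v2e v21 Ege => n v2e v21 Ege.
have t01 : 0 <= 2 * v n <= 1 by rewrite v21 andbT mulr_ge0// ltW.
have m1 : measurable_fun setT (fun x => 2 * v n * (f x - g x)) by meas.
have m2 : measurable_fun setT (fun x => 2 * v n * g x) by meas.
have h01 : 0 <= (2^-1 : R) <= 1 by lra.
have := Ee_convex m1 m2 h01 (Ee_scale mfg t01 fg) (ltW Ege).
rewrite (_ : (fun x => _) = (fun x => v n * f x)); last by apply/funext => x; lra.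
by move=> /le_trans; apply; rewrite lee_fin; lra.
Qed.

End RelaxedForm.

(** * Definiteness, embedding and completeness of the relaxed Luxemburg space *)

Section LuxemburgSpace.
Context {R : realType} {d : measure_display} {X : measurableType d}.
Variable mu : {measure set X -> \bar R}.
Variable E : (X -> R) -> \bar R.
Hypothesis hE : nonlinear_dirichlet_form mu E.
Hypothesis sf : sigma_finite setT mu.
Implicit Types f g h : X -> R.
Local Notation Ee := (Ee mu E).

Section Weighted.
Variable w : X -> R.
Hypotheses (mw : measurable_fun setT w) (w0 : forall x, 0 < w x).
Hypothesis hw : forall f, measurable_fun setT f ->
  (\int[mu]_x (`|f x| * w x)%:E <= luxnorm_e mu E f)%E.

Lemma weighted_kernel_trivial f : measurable_fun setT f -> luxnorm_e mu E f = 0%E ->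
  {ae mu, forall x, f x = 0}.
Proof.
move=> mf f0; have := hw mf; rewrite f0 => if0.
have mfw : measurable_fun setT (fun x => `|f x| * w x) by meas.
apply: filterS (integral_eq0_ae mfw _ if0) => [x /eqP|x]; last by rewrite mulr_ge0// ltW.
by rewrite mulf_eq0 (gt_eqF (w0 x)) orbF normr_eq0 => /eqP.
Qed.

Lemma weighted_embedding (u : nat -> X -> R) f : (forall n, measurable_fun setT (u n)) ->
  measurable_fun setT f ->
  (fun n => luxnorm_e mu E (fun x => u n x - f x)) @ \oo --> 0%E -> cvg_loc_measure mu u f.
Proof.
move=> mu' mf uf; apply: (weighted_L1_cvg_loc_measure mw w0) => //.
apply: (@squeeze_cvge _ _ _ _ (cst 0%E) _ _ _ _ _ uf); last exact: cvg_cst.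
apply: nearW => n; rewrite hw; last by meas.
by rewrite integral_ge0_EFin// => x; rewrite mulr_ge0// ltW.
Qed.

(** A subsequence with geometric steps converges almost everywhere by the weighted bound, and lower
    semicontinuity of the relaxed form carries the Cauchy estimate over to the limit. *)
Lemma weighted_complete (u : nat -> X -> R) : (forall n, MofEe mu E (u n)) ->
  (forall eps : R, 0 < eps -> exists N : nat, forall m n : nat, (N <= m)%N -> (N <= n)%N ->
    (luxnorm_e mu E (fun x => (u n x - u m x)%R) <= eps%:E)%E) ->
  exists f, MofEe mu E f /\
    (fun n => luxnorm_e mu E (fun x => (u n x - f x)%R)) @ \oo --> 0%E.
Proof.
move=> Mu cauchy; have mu' n : measurable_fun setT (u n) by case: (Mu n).
have t0 k : 0 < (2^-1 : R) ^+ k by rewrite exprn_gt0// invr_gt0.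
have /choice[N HN] := fun k => cauchy _ (t0 k).
pose s := fix s k := if k is k'.+1 then maxn (s k').+1 (N k'.+1) else N 0%N.
have sN k : (N k <= s k)%N by case: k => [|k] //=; rewrite leq_maxr.
have sS k : (s k < s k.+1)%N by rewrite /= leq_maxl.
have sk k : (k <= s k)%N by elim: k => // k IH; apply: leq_ltn_trans IH (sS k).
have [f [mf uf]] : exists f : X -> R, measurable_fun setT f /\
    {ae mu, forall x, u (s k) x @[k --> \oo] --> f x}.
  apply: (@ae_cvg_weighted_L1 _ _ _ mu w (fun k => u (s k)) 1) => // k.
  rewrite mul1r; apply: (@le_trans _ _ (luxnorm_e mu E (fun x => u (s k.+1) x - u (s k) x))).
    by apply: hw; meas.
  by apply: HN => //; apply: leq_trans (sN k) (ltnW (sS k)).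
(* Both signs are recorded: u_n - f serves norm convergence, f - u_n serves membership of the limit.
   Halving e supplies the strict inequality needed to leave the infimum. *)
have tail (e : R) : 0 < e -> \forall n \near \oo,
    (Ee (fun x => (e^-1 * (u n x - f x))%R) <= 1)%E /\ (Ee (fun x => (e^-1 * (f x - u n x))%R) <= 1)%E.
  move=> e0; have e20 : 0 < e / 2 by lra.
  have [M HM] := cauchy _ e20.
  exists M => // n /= Mn; split.
  - apply: (@Ee_lsc _ _ _ mu E (fun k x => e^-1 * (u n x - u (s k) x))).
    + by move=> k; meas.
    + by meas.
    + apply: filterS uf => x ux; apply: cvgM; first exact: cvg_cst.
      by apply: cvgB => //; exact: cvg_cst.
    + exists M => // k /= Mk; apply: (luxnorm_e_lt hE sf); first by meas.
      apply: (@le_lt_trans _ _ (e / 2)%:E); last by rewrite lte_fin; lra.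
      by apply: HM => //; exact: leq_trans Mk (sk k).
  - apply: (@Ee_lsc _ _ _ mu E (fun k x => e^-1 * (u (s k) x - u n x))).
    + by move=> k; meas.
    + by meas.
    + apply: filterS uf => x ux; apply: cvgM; first exact: cvg_cst.
      by apply: cvgB => //; exact: cvg_cst.
    + exists M => // k /= Mk; apply: (luxnorm_e_lt hE sf); first by meas.
      apply: (@le_lt_trans _ _ (e / 2)%:E); last by rewrite lte_fin; lra.
      by apply: HM => //; exact: leq_trans Mk (sk k).
exists f; split.
  have [n _ /(_ n (leqnn n))[_]] := tail 1 ltr01.
  by rewrite invr1; under eq_fun do rewrite mul1r; exact: MofEe_perturb.
apply: cvge0_le => [n|e e0]; first exact: luxnorm_e_ge0.
apply: filterS (tail e e0) => n [h _]; apply: ereal_inf_lbound.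
by exists e.
Qed.

End Weighted.

(** For f in the kernel the constant sequence f converges to 0 in the seminorm, hence locally in
    measure. A constant sequence of measures tending to 0 is 0, so f exceeds no positive level on
    any set of finite measure, and countably many such sets and levels suffice. *)
Lemma embedding_kernel_trivial :
  (forall (u : nat -> X -> R) (f : X -> R),
      (forall n, MofEe mu E (u n)) -> MofEe mu E f ->
      (fun n => luxnorm_e mu E (fun x => (u n x - f x)%R)) @ \oo --> 0%E ->
      cvg_loc_measure mu u f) ->
  forall f, MofEe mu E f -> luxnorm_e mu E f = 0%E -> {ae mu, forall x, f x = 0}.
Proof.
move=> emb f Mf f0; have [mf _] := Mf.
have M0 : MofEe mu E (fun=> 0).
  split; first exact: measurable_cst.
  under eq_fun do under eq_fun do rewrite mulr0.
  by rewrite (Ee_cst0 hE); exact: cvg_cst.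
have cv : cvg_loc_measure mu (fun=> f) (fun=> 0).
  apply: emb => //; under eq_fun do under eq_fun do rewrite subr0.
  by rewrite f0; exact: cvg_cst.
have [p [mp p0 p1 ip]] := sigma_finite_weight sf.
have t0 n : 0 < (n.+1%:R^-1 : R) by rewrite invr_gt0.
have null n : {ae mu, forall x, ~ (n.+1%:R^-1 <= p x /\ n.+1%:R^-1 < `|f x - 0|)}.
  have finA : finite_measure_set mu [set x | n.+1%:R^-1 <= p x].
    by apply: superlevel_finite_measure => // x; exact: ltW.
  exists ([set x | n.+1%:R^-1 <= p x] `&` [set x | n.+1%:R^-1 < `|f x - 0|]); split.
  - by apply: measurableI; [case: finA|exact: measurable_dist_gt].
  - exact: (cvg_unique (@ereal_hausdorff R) (cvg_cst _) (cv _ _ finA (t0 n))).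
  - by move=> x /= /contrapT.
apply: filterS (ae_foralln null) => x nx; apply/eqP; apply: contrapT => /negP fx.
have [n [n1 n2]] : exists n, n.+1%:R^-1 <= p x /\ n.+1%:R^-1 < `|f x|.
  have q0 : 0 < Num.min (p x) `|f x| by rewrite lt_min p0 normr_gt0.
  have : \forall n \near \oo, harmonic n < Num.min (p x) `|f x|.
    by apply: (cvgr_lt 0) => //; exact: cvg_harmonic.
  case=> n _ /(_ n (leqnn n)) /=; rewrite lt_min => /andP[/ltW h1 h2]; by exists n.
by apply: (nx n); rewrite subr0.
Qed.

End LuxemburgSpace.

Theorem theorem4p16 (R : realType) (d : measure_display) (X : measurableType d)
  (mu : {measure set X -> \bar R}) (mu_sf : sigma_finite setT mu)
  (E : (X -> R) -> \bar R)
  (hE : nonlinear_dirichlet_form mu E) (hD2 : weak_delta2 mu E) :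
  let cond_i := subcritical mu E in
  let cond_ii := exists w : X -> R, measurable_fun setT w /\ (forall x, 0 < w x) /\
      forall f, MofE mu E f -> (\int[mu]_x (`|f x| * w x)%:E <= luxnorm E f)%E in
  let cond_iii := forall f, MofEe mu E f -> luxnorm_e mu E f = 0%E ->
      {ae mu, forall x, f x = 0} in
  (* (M(E_e), ||.||_{L_e}) is a Banach space: ||.||_{L_e} is definite and complete *)
  let cond_iv := cond_iii /\
      forall u : nat -> X -> R, (forall n, MofEe mu E (u n)) ->
        (forall eps : R, 0 < eps -> exists N : nat, forall m n : nat, (N <= m)%N -> (N <= n)%N ->
           (luxnorm_e mu E (fun x => (u n x - u m x)%R) <= eps%:E)%E) ->
        exists f, MofEe mu E f /\
          (fun n => luxnorm_e mu E (fun x => (u n x - f x)%R)) @ \oo --> 0%E in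
  (* the embedding (M(E_e), ||.||_{L_e}) -> L^0(mu) is continuous *)
  let cond_v := forall (u : nat -> X -> R) (f : X -> R),
      (forall n, MofEe mu E (u n)) -> MofEe mu E f ->
      (fun n => luxnorm_e mu E (fun x => (u n x - f x)%R)) @ \oo --> 0%E ->
      cvg_loc_measure mu u f in
  [/\ cond_i <-> cond_ii, cond_ii <-> cond_iii, cond_iii <-> cond_iv
    & cond_iii <-> cond_v].
Proof.
move=> cond_i cond_ii cond_iii cond_iv cond_v.
(* The factor 1/2 lost in the relaxation is absorbed into the weight, which (ii) leaves free. *)
have relaxed : cond_ii -> exists w : X -> R, [/\ measurable_fun setT w, forall x, 0 < w x &
    forall f : X -> R, measurable_fun setT f -> (\int[mu]_x (`|f x| * w x)%:E <= luxnorm_e mu E f)%E].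
  move=> [w [mw [w0 hw]]]; exists (fun x => 2^-1 * w x); split; first by meas.
    by move=> x; rewrite mulr_gt0.
  exact: (hardy_relaxed hE mu_sf mw w0 hw).
have iii_ii : cond_iii -> cond_ii by exact: kernel_trivial_hardy.
have ii_iii : cond_ii -> cond_iii.
  by move=> /relaxed[w [mw w0 hw]] f [mf _]; exact: (weighted_kernel_trivial mw w0 hw).
split; split=> //.
- exact: subcritical_hardy.
- by move=> [w [mw [w0 hw]]]; exact: (hardy_subcritical hE mu_sf mw w0 hw).
- move=> h; split=> //; have [w [mw w0 hw]] := relaxed (iii_ii h).
  exact: (weighted_complete hE mu_sf mw w0 hw).
- by case.
- move=> /iii_ii/relaxed[w [mw w0 hw]] u f Mu [mf _].
  by apply: (weighted_embedding mw w0 hw) => // n; case: (Mu n).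
- exact: embedding_kernel_trivial.
Qed.
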